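(* Let $\Omega=\mathbf{R}^n$, $n\ge1$, and let $\sigma$ be the radial potential $$\sigma(x)=\cos r+\frac{n-1}{r}\sin r-\sin^2r,\qquad r=|x|.$$ Then $$\langle\sigma,h^2\rangle\le\int_{\mathbf{R}^n}|\nabla h|^2\,dx\quad\text{for all }h\in C_0^\infty(\mathbf{R}^n),$$ but there do not exist $\vec\Phi\in L^2_{\rm loc}(\mathbf{R}^n)^n$ and $C>0$ such that $$\sigma\le{\rm div}(\vec\Phi)\ \text{ in }D'(\mathbf{R}^n)\quad\text{and}\quad\int_{\mathbf{R}^n}|h|^2|\vec\Phi|^2\,dx\le C\int_{\mathbf{R}^n}|\nabla h|^2\,dx\ \text{ for all }h\in C_0^\infty(\mathbf{R}^n).$$
   Context: Here $\langle\sigma,h^2\rangle=\int_{\mathbf{R}^n}\sigma h^2\,dx$. An inequality $\mu\le\nu$ in $D'(\mathbf{R}^n)$ means $\langle\mu,\varphi\rangle\le\langle\nu,\varphi\rangle$ for all $\varphi\in C_0^\infty(\mathbf{R}^n)$ with $\varphi\ge0$. *)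

(* Defs.v *)
From HB Require Import structures.
From mathcomp Require Import all_boot all_order all_algebra.
From mathcomp Require Import all_classical all_reals all_analysis.
Set Implicit Arguments.
Unset Strict Implicit.
Unset Printing Implicit Defensive.
Import Order.TTheory GRing.Theory Num.Theory.
Import numFieldNormedType.Exports.
Local Open Scope classical_set_scope.
Local Open Scope ring_scope.

Definition measure_rV_display : measure_display.
Proof. exact: default_measure_display. Qed.

(* The Borel sigma-algebra of R^n, generated by the coordinates (the library
   does the same for n.-tuple T). *)
Section measurable_rV.
Context {R : realType}.
Variable n : nat.

Definition coord_rV (i : 'I_n) (x : 'rV[R]_n) : measurableTypeR R := x ord0 i.

Let rV_set0 : g_sigma_preimage coord_rV set0.
Proof. exact: sigma_algebra0. Qed.

Let rV_setC A : g_sigma_preimage coord_rV A -> g_sigma_preimage coord_rV (~` A).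
Proof. exact: sigma_algebraC. Qed.

Let rV_bigcup (F : _^nat) : (forall i, g_sigma_preimage coord_rV (F i)) ->
  g_sigma_preimage coord_rV (\bigcup_i (F i)).
Proof. exact: sigma_algebra_bigcup. Qed.

HB.instance Definition _ := @isMeasurable.Build measure_rV_display
  'rV[R]_n (g_sigma_preimage coord_rV) rV_set0 rV_setC rV_bigcup.

End measurable_rV.

Section measurable_rV_theory.
Context {R : realType}.

Lemma measurable_coord_rV n (i : 'I_n) :
  measurable_fun [set: 'rV[R]_n] (coord_rV i).
Proof.
move=> _ Y mY; rewrite setTI; apply: sub_sigma_algebra => /=.
rewrite -bigcup_seq/=; exists i => /=; first by rewrite mem_index_enum.
by exists Y => //; rewrite setTI.
Qed.

Lemma measurable_fun_rVP d (T : measurableType d) n (f : T -> 'rV[R]_n) :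
  measurable_fun [set: T] f <->
  forall i, measurable_fun [set: T] (coord_rV i \o f).
Proof.
split=> [mf i|mf].
  by apply: measurableT_comp => //; exact: measurable_coord_rV.
have H : g_sigma_preimage (fun i => coord_rV i \o f) `<=` measurable.
  apply: smallest_sub; first exact: sigma_algebra_measurable.
  case: n => [|n] in f mf *; first by rewrite big_ord0.
  rewrite -bigcup_mkord_ord; apply: bigcup_sub => i Ii.
  by move=> A [B mB <-]; exact: mf.
rewrite g_sigma_preimage_comp in H.
by move=> _ A mA; apply: H; exists A.
Qed.

Definition cons_rV n (p : measurableTypeR R * 'rV[R]_n) : 'rV[R]_n.+1 :=
  row_mx (p.1 : R)%:M p.2.

Definition uncons_rV n (x : 'rV[R]_n.+1) : measurableTypeR R * 'rV[R]_n :=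
  (x ord0 ord0, @rsubmx R 1 1 n x).

Lemma cons_rV0 n p : @cons_rV n p ord0 ord0 = p.1.
Proof.
have := @row_mxEl R 1 1 n (p.1 : R)%:M p.2 ord0 ord0.
rewrite [RHS]mxE eqxx mulr1n => <-.
by congr (row_mx _ _ _ _); exact: val_inj.
Qed.

Lemma cons_rVS n p (j : 'I_n) : cons_rV p ord0 (lift ord0 j) = p.2 ord0 j.
Proof.
rewrite -(@row_mxEr R 1 1 n (p.1 : R)%:M p.2 ord0 j).
by congr (row_mx _ _ _ _); exact: val_inj.
Qed.

Lemma uncons_rVK n : cancel (@uncons_rV n) (@cons_rV n).
Proof.
move=> x; apply/rowP => i; case: (unliftP ord0 i) => [j|] ->.
  by rewrite cons_rVS mxE; congr (x _ _); exact: val_inj.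
by rewrite cons_rV0.
Qed.

Lemma cons_rVK n : cancel (@cons_rV n) (@uncons_rV n).
Proof.
move=> [a v]; rewrite /uncons_rV cons_rV0 /=; congr (_, _).
exact: row_mxKr.
Qed.

Lemma measurable_cons_rV n : measurable_fun setT (@cons_rV n).
Proof.
apply/measurable_fun_rVP => i; case: (unliftP ord0 i) => [j|] ->.
  rewrite (_ : _ \o _ = coord_rV j \o snd).
    by apply: measurableT_comp => //; exact: measurable_coord_rV.
  by apply/funext => p; rewrite /coord_rV /= cons_rVS.
rewrite (_ : _ \o _ = fst) //.
by apply/funext => p; rewrite /coord_rV /= cons_rV0.
Qed.

Lemma measurable_uncons_rV n : measurable_fun setT (@uncons_rV n).
Proof.
apply/measurable_fun_pairP; split; first exact: (measurable_coord_rV ord0).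
apply/measurable_fun_rVP => i.
rewrite (_ : _ \o _ = coord_rV (lift ord0 i)); first exact: measurable_coord_rV.
by apply/funext => x; rewrite /coord_rV /= mxE; congr (x _ _); exact: val_inj.
Qed.

End measurable_rV_theory.

(* One step of the construction of Lebesgue measure: the product of Lebesgue
   measure on R with a measure on R^n, carried to R^n.+1 = R * R^n. *)
Section lebesgue_rV_step.
Context {R : realType} (n : nat).
Variable mu : {sigma_finite_measure set 'rV[R]_n -> \bar R}.

Definition lebesgue_cons_rV : set 'rV[R]_n.+1 -> \bar R :=
  pushforward (lebesgue_measure \x mu)%E (@cons_rV R n).

Let lebesgue_cons_rV0 : lebesgue_cons_rV set0 = 0%E.
Proof. by rewrite /lebesgue_cons_rV /pushforward preimage_set0 measure0. Qed.

Let lebesgue_cons_rV_ge0 A : (0 <= lebesgue_cons_rV A)%E.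
Proof. by rewrite /lebesgue_cons_rV /pushforward; exact: measure_ge0. Qed.

Let lebesgue_cons_rV_sigma_additive : semi_sigma_additive lebesgue_cons_rV.
Proof.
have mc A : measurable A -> measurable (@cons_rV R n @^-1` A).
  by move=> mA; rewrite -[X in measurable X]setTI; exact: measurable_cons_rV.
move=> F mF tF mUF; rewrite /lebesgue_cons_rV /pushforward preimage_bigcup.
apply: measure_semi_sigma_additive.
- by move=> k; exact: mc.
- apply/trivIsetP => /= i j _ _ ij; rewrite -preimage_setI.
  by move/trivIsetP : tF => /(_ _ _ _ _ ij) -> //; rewrite preimage_set0.
- by rewrite -preimage_bigcup; exact: mc.
Qed.

HB.instance Definition _ := isMeasure.Build _ _ _ lebesgue_cons_rV
  lebesgue_cons_rV0 lebesgue_cons_rV_ge0 lebesgue_cons_rV_sigma_additive.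

Let lebesgue_cons_rV_sigma_finite : sigma_finite setT lebesgue_cons_rV.
Proof.
have /sigma_finiteP[F [FT ndF Foo]] := sigma_finiteT (@lebesgue_measure R).
have /sigma_finiteP[G [GT ndG Goo]] := sigma_finiteT mu.
exists (fun k => @uncons_rV R n @^-1` (F k `*` G k)).
  rewrite -preimage_bigcup; apply/esym/seteqP; split=> // x _ /=.
  have [j _ Fj] : (\bigcup_k F k) (uncons_rV x).1 by rewrite -FT.
  have [k _ Gk] : (\bigcup_k G k) (uncons_rV x).2 by rewrite -GT.
  exists (maxn j k) => //; split.
    by move: Fj; exact/subsetPset/ndF/leq_maxl.
  by move: Gk; exact/subsetPset/ndG/leq_maxr.
move=> k; have [mF Fk] := Foo k; have [mG Gk] := Goo k; split.
  rewrite -[X in measurable X]setTI; apply: measurable_uncons_rV => //.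
  exact: measurableX.
rewrite /lebesgue_cons_rV /pushforward -comp_preimage.
rewrite (_ : _ \o _ = id); last by apply/funext => p; exact: cons_rVK.
by rewrite preimage_id product_measure1E// lte_mul_pinfty// ge0_fin_numE.
Qed.

HB.instance Definition _ := Measure_isSigmaFinite.Build _ _ _ lebesgue_cons_rV
  lebesgue_cons_rV_sigma_finite.

End lebesgue_rV_step.

Fixpoint lebesgue_rV (R : realType) (n : nat) :
    {sigma_finite_measure set 'rV[R]_n -> \bar R} :=
  match n with
  | 0 => dirac (0 : 'rV[R]_0)
  | m.+1 => lebesgue_cons_rV (lebesgue_rV R m)
  end.

Lemma lebesgue_rV_box (R : realType) (n : nat)
    (A : 'I_n -> set (measurableTypeR R)) : (forall i, measurable (A i)) ->
  lebesgue_rV R n [set x | forall i, A i (x ord0 i)] =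
  (\prod_(i < n) lebesgue_measure (A i))%E.
Proof.
elim: n A => [|n IH] A mA.
  by rewrite big_ord0 /= diracE mem_set// => -[].
have mS : measurable [set x : 'rV[R]_n | forall i, A (lift ord0 i) (x ord0 i)].
  rewrite (_ : mkset _ = \bigcap_(i in [set: 'I_n])
      (coord_rV i @^-1` A (lift ord0 i))).
    apply: fin_bigcap_measurable => // i _.
    by rewrite -[X in measurable X]setTI; exact: measurable_coord_rV.
  by apply/seteqP; split => [x Ax i _|x Ax i]; exact: Ax.
rewrite big_ord_recl -IH //= /lebesgue_cons_rV /pushforward.
rewrite -product_measure1E //.
congr (_ _); apply/seteqP; split => [p /= Ap|p /= [A0 AS] i].
  split; first by rewrite /= -cons_rV0; exact: Ap.
  by move=> i; rewrite -cons_rVS; exact: Ap.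
by case: (unliftP ord0 i) => [j|] ->; rewrite ?cons_rVS ?cons_rV0.
Qed.

Section euclidean_calculus.
Context {R : realType} {n : nat}.
Implicit Types (f h : 'rV[R]_n -> R) (Phi : 'rV[R]_n -> 'rV[R]_n).

(* The library's norm on 'rV[R]_n is the sup norm. *)
Definition sqnorm_rV (x : 'rV[R]_n) : R := \sum_i x ord0 i ^+ 2.

Definition enorm (x : 'rV[R]_n) : R := Num.sqrt (sqnorm_rV x).

Definition dot_rV (x y : 'rV[R]_n) : R := \sum_i x ord0 i * y ord0 i.

Definition partial (i : 'I_n) f (x : 'rV[R]_n) : R := 'D_(delta_mx ord0 i) f x.

Definition gradient f (x : 'rV[R]_n) : 'rV[R]_n := \row_i partial i f x.

Fixpoint Ck (k : nat) f : Prop :=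
  match k with
  | 0 => continuous f
  | k'.+1 => continuous f /\ forall i,
      (forall x, derivable f x (delta_mx ord0 i)) /\ Ck k' (partial i f)
  end.

Definition smooth f := forall k, Ck k f.

Definition compactly_supported f := compact (closure [set x | f x != 0]).

Definition test_function f := smooth f /\ compactly_supported f.

Definition L2loc Phi := measurable_fun setT Phi /\
  forall K : set 'rV[R]_n, compact K ->
    (\int[lebesgue_rV R n]_(x in K) (sqnorm_rV (Phi x))%:E < +oo)%E.

(* Distributions are represented by their values on test functions; below,
   those of a function f and of the divergence of a vector field Phi. *)
Definition distr_of_fun f (phi : 'rV[R]_n -> R) : \bar R :=
  \int[lebesgue_rV R n]_x (f x * phi x)%:E.

Definition distr_div Phi (phi : 'rV[R]_n -> R) : \bar R :=
  (- \int[lebesgue_rV R n]_x (dot_rV (Phi x) (gradient phi x))%:E)%E.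

Definition distr_le (mu nu : ('rV[R]_n -> R) -> \bar R) :=
  forall phi, test_function phi -> (forall x, 0 <= phi x) ->
    (mu phi <= nu phi)%E.

Definition dirichlet h : \bar R :=
  \int[lebesgue_rV R n]_x (sqnorm_rV (gradient h x))%:E.

(* At x = 0 the quotient is 0 as _ / 0 = 0; this changes the potential on a
   null set only. *)
Definition sigma_potential (x : 'rV[R]_n) : R :=
  let r := enorm x in
  cos r + (n%:R - 1) / r * sin r - sin r ^+ 2.

End euclidean_calculus.

(* Main.v *)
Require Import Defs.
From mathcomp Require Import all_boot all_order all_algebra.
From mathcomp Require Import all_classical all_reals all_analysis.
From mathcomp Require Import measurable_realfun ring lra.
Import Order.TTheory GRing.Theory Num.Theory.
Import numFieldNormedType.Exports.
Set Implicit Arguments.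
Unset Strict Implicit.
Unset Printing Implicit Defensive.
Local Open Scope classical_set_scope.
Local Open Scope ring_scope.

(* With [F = sin r x / r] one has [sigma = div F - |F|^2], so that
   [|grad h|^2 - sigma h^2 = |grad h + h F|^2 - div (F h^2)], and the divergence
   integrates to zero.

   For the second part, let [B] be a smooth cutoff of a cube of side [~ L] placed
   so far out on the first axis that [sigma] is close to [cos x_0 - sin^2 x_0]
   on it, and test with [(1 + cos x_0)^2 B^2].  The product
   [(cos - sin^2) (1 + cos)^2] has mean [3/8 > 0], so the left-hand side is at
   least [~ L^n].  Since [|grad B| = O(1 / L)], the bound on [Phi] with [h = B]
   gives [int B^2 |Phi|^2 = O(L^(n-2))], and by AM-GM with weight [L] the
   pairing with [div Phi] is [O(L^(n-1))], too small when [L] is large. *)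

(** Over large cubes [sigma] has mean close to -1/2, so a plain cutoff cannot separate it from a
    divergence; the weight favours the places where cos x_0 is near 1. A single factor 1 + cos x_0
    would not do, since (cos - sin^2) (1 + cos) has mean 0; the square is the first power that makes
    the mean positive. This weight varies at unit scale, so its gradient does not decay with L. What
    decays is the mean of |Phi|^2 over the cube, of order L^-2, and [B] enters squared so that the
    gradient of the test function keeps one factor [B] to go with Phi. The weight L in AM-GM gives
    its two halves, L L^(n-2) and L^n / L, the same order. The field F itself is no candidate for
    Phi: |F|^2 = sin^2 r has mean about 1/2 on such cubes. *)

(** * Smooth functions on the line that vanish on a half-line *)

Section flat.
Context {R : realType}.
Implicit Types (p : {poly R}) (s t u : R).

(** [flat 1] is the classical exp(-1/s). The polynomial factor in 1/s makes the family closed under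
    differentiation, so that every derivative of [flat 1] is again some [flat p]. *)
Definition flat p s : R := if 0 < s then p.[s^-1] * expR (- s^-1) else 0.

Lemma exprn_expRN_le u k : 0 <= u -> u ^+ k * expR (- u) <= k`!%:R.
Proof.
move=> u0; rewrite expRN ler_pdivrMr ?expR_gt0//.
case: k => [|k].
  by rewrite expr0 fact0 mul1r -expR0 ler_expR.
rewrite -ler_pdivrMl ?ltr0n ?fact_gt0// mulrC.
by apply: le_trans (expR_ge1Dxn k u0); rewrite lerDr.
Qed.

Lemma horner_expRN_bounded p :
  exists2 K, 0 <= K & forall u, 0 <= u -> `|p.[u]| * expR (- u) <= K.
Proof.
(* The extra power u^k lets the induction on [p] close: in p X + c the factor X is moved into
   u^k. *)
suff H k : exists2 K, 0 <= K &
    forall u, 0 <= u -> `|p.[u]| * (u ^+ k * expR (- u)) <= K.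
  by have [K K0 HK] := H 0%N; exists K => // u /HK; rewrite expr0 mul1r.
elim/poly_ind: p k => [|p c IH] k.
  by exists 0 => // u _; rewrite horner0 normr0 mul0r.
have [K K0 HK] := IH k.+1; exists (K + `|c| * k`!%:R) => [|u u0].
  by rewrite addr_ge0// mulr_ge0// ler0n.
rewrite hornerMXaddC.
apply: (@le_trans _ _ ((`|p.[u]| * u + `|c|) * (u ^+ k * expR (- u)))).
  rewrite ler_wpM2r// ?mulr_ge0 ?exprn_ge0 ?expR_ge0//.
  by rewrite (le_trans (ler_normD _ _))// normrM (ger0_norm u0).
rewrite mulrDl lerD//; last by rewrite ler_wpM2l// exprn_expRN_le.
by rewrite -mulrA [u * _]mulrA -exprS HK.
Qed.

Lemma flat_le0 p s : s <= 0 -> flat p s = 0.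
Proof. by rewrite /flat ltNge => ->. Qed.

Lemma flat_gt0 p s : 0 < s -> flat p s = p.[s^-1] * expR (- s^-1).
Proof. by rewrite /flat => ->. Qed.

Lemma flat_bounded p : exists2 K, 0 <= K & forall s, `|flat p s| <= K.
Proof.
have [K K0 HK] := horner_expRN_bounded p; exists K => // s.
rewrite /flat; case: ifPn => [s0|_]; last by rewrite normr0.
by rewrite normrM [`|expR _|]ger0_norm ?expR_ge0// HK// invr_ge0 ltW.
Qed.

(** Boundedness for X^2 p is boundedness of s^-2 [flat p s]. Quadratic decay is what
    differentiability at 0 needs. *)
Lemma flat_quadratic p : exists2 K, 0 <= K & forall s, `|flat p s| <= K * s ^+ 2.
Proof.
have [K K0 HK] := flat_bounded ('X^2 * p); exists K => // s.
have [s0|s0] := ltP 0 s; last first.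
  by rewrite flat_le0// normr0 mulr_ge0// sqr_ge0.
have := HK s; rewrite !flat_gt0// hornerM hornerXn -mulrA normrM.
rewrite [`|_ ^+ 2|]ger0_norm ?sqr_ge0// exprVn mulrC.
by rewrite ler_pdivrMr// exprn_gt0.
Qed.

Definition flat_next p := 'X^2 * (p - p^`()).

Lemma is_derive_inv_pos s : 0 < s -> is_derive s 1 (@GRing.inv R) (- s ^- 2).
Proof.
move=> s0; have := @is_deriveV R id s 1 1 (lt0r_neq0 s0) (is_derive_id _ _).
by rewrite /= scaler1.
Qed.

Lemma is_derive_flat p s : is_derive s 1 (flat p) (flat (flat_next p) s).
Proof.
have [s0|s0|->] := ltgtP s 0.
- rewrite flat_le0 ?ltW//; apply: (@near_eq_is_derive _ _ _ (cst 0)).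
  by near=> t; rewrite flat_le0// ltW//; near: t; exact: lt_nbhsl.
- pose g t := p.[t^-1] * expR (- t^-1).
  apply: (@near_eq_is_derive _ _ _ g).
    near=> t; rewrite flat_gt0//; near: t; exact: lt_nbhsr.
  have dV := is_derive_inv_pos s0.
  have dp := @is_derive1_comp _ _ _ _ _ _ (is_derive_poly p s^-1) dV.
  have de : is_derive s 1 (fun t : R => expR (- t^-1)) (expR (- s^-1) * (s ^- 2)).
    have := @is_derive1_comp _ expR (- GRing.inv) s _ _ (is_derive_expR _)
      (is_deriveN dV).
    by rewrite opprK.
  apply: (is_derive_eq (is_deriveM dp de)).
  rewrite flat_gt0// /flat_next hornerM hornerXn hornerD hornerN -exprVn /=.
  by rewrite /GRing.scale /=; ring.
(* At 0 the difference quotient is squeezed between -K |h| and K |h|. *)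
- rewrite flat_le0//; have [K K0 HK] := flat_quadratic p.
  suff H : (h^-1 *: (flat p (h *: 1 + 0) - flat p 0)) @[h --> 0^'] --> (0 : R).
    by split; [apply/cvg_ex; exists 0 | exact: cvg_lim H].
  apply: (@squeeze_cvgr _ _ _ _ (fun h => - (K * `|h|)) (fun h => K * `|h|)).
  + near=> h; rewrite -ler_norml [flat p 0]flat_le0// subr0 addr0.
    rewrite /GRing.scale /= mulr1.
    have h0 : h != 0 by near: h; exact: nbhs_dnbhs_neq.
    rewrite normrM normfV ler_pdivrMl ?normr_gt0//.
    by rewrite mulrCA -expr2 real_normK ?num_real.
  + rewrite -[X in _ --> X]oppr0 -[X in - X](mulr0 K) -[X in K * X](@normr0 R R).
    apply: cvgN; apply: cvgMr; apply: cvg_norm; exact: (@nbhs_dnbhs _ (0 : R)).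
  + rewrite -[X in _ --> X](mulr0 K) -[X in K * X](@normr0 R R).
    apply: cvgMr; apply: cvg_norm; exact: (@nbhs_dnbhs _ (0 : R)).
Unshelve. all: by end_near.
Qed.

End flat.

(** * Partial derivatives along coordinate lines, and the classes [Ck] *)

Section partial_derivatives.
Context {R : realType}.

(** A directional derivative depends only on the values along one line, even when the two functions
    live on different spaces. This is the bridge between partial derivatives and one-variable
    calculus. *)
Lemma is_derive_quotient (V W : normedModType R) (f : V -> R) (g : W -> R)
    (a v : V) (b w : W) (d : R) :
  (forall h : R, f (h *: v + a) = g (h *: w + b)) ->
  is_derive a v f d -> is_derive b w g d.
Proof.
move=> fg [df Df].
have fg0 : f a = g b by have := fg 0; rewrite !scale0r !add0r.
have E : (fun h : R => h^-1 *: ((f \o shift a) (h *: v) - f a)) =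
         (fun h : R => h^-1 *: ((g \o shift b) (h *: w) - g b)).
  by apply/funext => h /=; rewrite fg fg0.
by split; [move: df; rewrite /derivable E|rewrite -Df /derive E].
Qed.

Context {n : nat}.
Implicit Types (x y : 'rV[R]_n) (f g : 'rV[R]_n -> R) (i j : 'I_n).

Definition upd i x (t : R) : 'rV[R]_n := \row_j (if j == i then t else x ord0 j).

Lemma updE i x t j : upd i x t ord0 j = if j == i then t else x ord0 j.
Proof. by rewrite mxE. Qed.

Lemma upd_id i x : upd i x (x ord0 i) = x.
Proof. by apply/rowP => j; rewrite updE; case: eqP => [->|]. Qed.

Lemma updD i x t s : s *: delta_mx ord0 i + upd i x t = upd i x (s + t).
Proof.
apply/rowP => j; rewrite !mxE eqxx/=; case: eqP => _ /=.
  by rewrite mulr1.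
by rewrite mulr0 add0r.
Qed.

Lemma shift_upd i x s : s *: delta_mx ord0 i + x = upd i x (s + x ord0 i).
Proof. by rewrite -{1}(upd_id i x) updD. Qed.

Lemma is_derive_upd f i x t d : is_derive (upd i x t) (delta_mx ord0 i) f d ->
  is_derive t 1 (fun t => f (upd i x t)) d.
Proof.
by apply: is_derive_quotient => h; rewrite updD /GRing.scale/= mulr1.
Qed.

Lemma is_derive_of_line f i x d :
  is_derive (x ord0 i) 1 (fun t => f (upd i x t)) d ->
  is_derive x (delta_mx ord0 i) f d.
Proof.
by apply: is_derive_quotient => h; rewrite shift_upd /GRing.scale/= mulr1.
Qed.

Lemma continuous_upd i x : continuous (upd i x).
Proof.
move=> t; rewrite (_ : upd i x = fun t => (t - x ord0 i) *: delta_mx ord0 i + x).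
  apply: cvgD; last exact: cvg_cst.
  by apply: cvgZr_tmp; apply: cvgB; [exact: cvg_id|exact: cvg_cst].
by apply/funext => s; rewrite shift_upd subrK.
Qed.

Lemma is_derive_coord (g : R -> R) (d : R) i j x :
  is_derive (x ord0 i) 1 g d ->
  is_derive x (delta_mx ord0 j) (fun x => g (x ord0 i)) (d *+ (i == j)).
Proof.
move=> gd; apply: is_derive_of_line; have [<-|ij] := eqVneq i j.
  rewrite mulr1n; apply: is_derive_quotient gd => h.
  by rewrite updE eqxx.
rewrite mulr0n; apply: (is_derive_quotient _ (is_derive_cst (g (x ord0 i)) (0 : R) 0)).
by move=> h /=; rewrite updE (negbTE ij).
Qed.

Lemma CkW k f : Ck k.+1 f -> Ck k f.
Proof.
elim: k f => [f []//|k IH f [cf pf]]; split=> // i.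
by have [df /IH] := pf i.
Qed.

Lemma Ck_cst k (c : R) : Ck k (fun _ : 'rV[R]_n => c).
Proof.
elim: k c => [|k IH] c; first exact: cst_continuous.
split=> [|i]; first exact: cst_continuous.
split=> [x|]; first by case: (is_derive_cst c x (delta_mx ord0 i)).
rewrite (_ : partial i _ = fun=> 0); first exact: IH.
by apply/funext => x; exact: derive_cst.
Qed.

Lemma CkD k f g : Ck k f -> Ck k g -> Ck k (fun x => f x + g x).
Proof.
elim: k f g => [|k IH] f g.
  by move=> cf cg x; exact: cvgD (cf x) (cg x).
move=> [cf pf] [cg pg]; split=> [x|i]; first exact: cvgD (cf x) (cg x).
have [[df pfi] [dg pgi]] := (pf i, pg i).
split=> [x|]; first exact: derivableD.
rewrite (_ : partial i _ = fun x => partial i f x + partial i g x); first exact: IH.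
by apply/funext => x; exact: deriveD.
Qed.

Lemma CkM k f g : Ck k f -> Ck k g -> Ck k (fun x => f x * g x).
Proof.
elim: k f g => [|k IH] f g.
  by move=> cf cg x; exact: cvgM (cf x) (cg x).
move=> Cf Cg; have [[cf pf] [cg pg]] := (Cf, Cg).
split=> [x|i]; first exact: cvgM (cf x) (cg x).
have [[df pfi] [dg pgi]] := (pf i, pg i).
split=> [x|]; first exact: derivableM.
rewrite (_ : partial i _ = fun x => f x * partial i g x + g x * partial i f x).
  by apply: CkD; apply: IH => //; exact: CkW.
by apply/funext => x; exact: deriveM.
Qed.

Lemma Ck_prod k (I : Type) (r : seq I) (F : I -> 'rV[R]_n -> R) :
  (forall a, Ck k (F a)) -> Ck k (fun x => \prod_(a <- r) F a x).
Proof.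
move=> CF; elim: r => [|a r IH].
  rewrite (_ : (fun x => _) = fun=> 1); first exact: Ck_cst.
  by apply/funext => x; rewrite big_nil.
rewrite (_ : (fun x => _) = fun x => F a x * \prod_(a <- r) F a x).
  exact: CkM.
by apply/funext => x; rewrite big_cons.
Qed.

(** Listing all derivatives of a one-variable function as a sequence [G] turns smoothness in a
    coordinate into a plain induction on [k]; it serves both [flat] and the cosine. *)
Lemma Ck_coord k (G : nat -> R -> R) m i :
  (forall m (t : R), is_derive t 1 (G m) (G m.+1 t)) ->
  Ck k (fun x => G m (x ord0 i)).
Proof.
move=> dG.
have cG m' : continuous (fun x => G m' (x ord0 i)).
  move=> x; apply: (@continuous_comp _ _ _ (fun x => x ord0 i)).
    exact: coord_continuous.
  by apply: differentiable_continuous; apply/derivable1_diffP; case: (dG m' (x ord0 i)).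
elim: k m => [|k IH] m //; split=> // j.
have d x := @is_derive_coord _ _ i j x (dG m _).
split=> [x|]; first by case: (d x).
rewrite (_ : partial j _ = fun x => (i == j)%:R * G m.+1 (x ord0 i)).
  by apply: CkM; [exact: Ck_cst|exact: IH].
by apply/funext => x; rewrite /partial derive_val mulr_natl.
Qed.

Lemma smooth_is_derive f i x : smooth f ->
  is_derive x (delta_mx ord0 i) f (partial i f x).
Proof. by move=> /(_ 1%N)[_ /(_ i)[+ _]] => /(_ x)/derivableP. Qed.

Lemma smooth_continuous f : smooth f -> continuous f.
Proof. by move=> /(_ 0%N). Qed.

Lemma smooth_partial_continuous f i : smooth f -> continuous (partial i f).
Proof. by move=> /(_ 1%N)[_ /(_ i)[]]. Qed.

Lemma test_function_support f : test_function f -> exists2 M, 0 < M &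
  (forall x, ~ (forall i, `|x ord0 i| <= M) ->
     f x = 0 /\ forall i, partial i f x = 0).
Proof.
move=> [_ /compact_bounded[M0 [_ HM]]].
pose M := Num.max M0 0 + 1.
have M0M : M0 < M by rewrite ltr_pwDr// le_max lexx.
have MP : 0 < M by rewrite ltr_pwDr// le_max lexx orbT.
exists M => // x xM; have nfx : ~ closure [set x | f x != 0] x.
  move=> /(HM _ M0M) /= xleM; apply: xM => i; apply: le_trans xleM.
  by rewrite [leRHS]/Num.Def.normr/= mx_normrE; exact: (le_bigmax _ _ (ord0, i)).
(* Off the closed support [f] vanishes on a whole neighbourhood, and so do its derivatives. *)
have f0 : \forall y \near x, f y = 0.
  have [U [Ux Uf]] : exists U, nbhs x U /\ forall y, U y -> f y = 0.
    apply: contrapT => H; apply: nfx => U Ux.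
    apply: contrapT => H'; apply: H; exists U; split=> // y Uy.
    by apply/eqP/negPn/negP => fy; apply: H'; exists y.
  by apply: filterS Ux.
split; first exact: nbhs_singleton f0.
move=> i; rewrite /partial (near_eq_derive _ (g := cst 0)) ?derive_cst//.
Qed.

End partial_derivatives.

(** * Cubes, open sets and integrability *)

Section cubes.
Context {R : realType} {n : nat}.
Implicit Types (c x : 'rV[R]_n) (M K : R) (f : 'rV[R]_n -> R).

Definition cube c M : set 'rV[R]_n := [set x | forall i, `|x ord0 i - c ord0 i| <= M].

Lemma cube_itv c M :
  cube c M = [set x | forall i,
    `[c ord0 i - M, c ord0 i + M]%classic (x ord0 i : measurableTypeR R)].
Proof.
by apply/seteqP; split => x cx i; have := cx i; rewrite /= in_itv/= ler_distl.
Qed.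

Lemma measurable_cube c M : measurable (cube c M).
Proof.
rewrite (_ : cube c M = \bigcap_(i in [set: 'I_n])
    (coord_rV i @^-1` `[c ord0 i - M, c ord0 i + M]%classic)).
  apply: fin_bigcap_measurable => // i _.
  by rewrite -[X in measurable X]setTI; exact: measurable_coord_rV.
rewrite cube_itv.
by apply/seteqP; split => [x Ax i _|x Ax i]; [exact: Ax|exact: (Ax i I)].
Qed.

Lemma lebesgue_cube c M : 0 <= M -> lebesgue_rV R n (cube c M) = ((2 * M) ^+ n)%:E.
Proof.
move=> M0; rewrite cube_itv.
rewrite (@lebesgue_rV_box R n
  (fun i => `[c ord0 i - M, c ord0 i + M]%classic))// (eq_bigr (fun=> (2 * M)%:E)).
  by rewrite prodEFin prodr_const card_ord.
move=> i _; rewrite lebesgue_measure_itv /= lte_fin.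
have [MM|] := ltP (c ord0 i - M) (c ord0 i + M); first by congr (_%:E); ring.
by rewrite lerD2l => MN; congr (_%:E); lra.
Qed.

(** The sigma-algebra is generated by the coordinates, so open sets have to be recovered from boxes:
    [U] is the union of the countably many cubes with rational centre and half-side 1/(m+1) that lie
    inside it. *)
Lemma open_measurable_rV (U : set 'rV[R]_n) : open U -> measurable U.
Proof.
move=> oU; pose C (p : 'rV[rat]_n * nat) := cube (map_mx ratr p.1) (p.2.+1%:R^-1).
rewrite (_ : U = \bigcup_p (if `[< C p `<=` U >] then C p else set0)).
  apply: countable_bigcupT_measurable => // p.
  by case: ifPn => // _; exact: measurable_cube.
apply/seteqP; split => [x Ux|x [p _]]; last by case: asboolP => // CU /CU.
have /nbhs_ballP[e /= e0 eU] : nbhs x U by exact: open_nbhs_nbhs.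
have [m me] : exists m : nat, m.+1%:R^-1 < e / 2.
  exists (Num.truncn (e / 2)^-1).
  by rewrite invf_plt ?posrE ?divr_gt0// truncnS_gt.
have q_ i : {q : rat | (ratr q : R) \in `]x ord0 i - m.+1%:R^-1, x ord0 i + m.+1%:R^-1[}.
  by apply/cid/rat_in_itvoo; rewrite ltrD2l gtrN.
pose q : 'rV[rat]_n := \row_i sval (q_ i).
have qx i : `|x ord0 i - ratr (q ord0 i)| < m.+1%:R^-1.
  by rewrite mxE; have := svalP (q_ i); rewrite in_itv/= distrC ltr_distl.
exists (q, m) => //; case: asboolP => [_|[]].
  by move=> i; rewrite /= mxE ltW.
move=> y Cy; apply: eU; rewrite mx_norm_ball /ball_ /= /Num.Def.normr/= mx_normrE.
apply/bigmax_ltP; split=> // -[a i] _; rewrite /= ord1 !mxE.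
have := Cy i; rewrite /= mxE => yq; have xq := qx i.
rewrite -(subrKA (ratr (q ord0 i))) (le_lt_trans (ler_normD _ _))//.
by rewrite [e]splitr ltrD ?(lt_trans xq)// distrC (le_lt_trans yq).
Qed.

Lemma continuous_measurable_rV f : continuous f -> measurable_fun setT f.
Proof.
move=> /continuousP cf; apply: (measurability _ (RGenOpens.measurableE R)).
move=> _ [_ [a [b ->] <-]]; rewrite setTI; apply: open_measurable_rV.
exact/cf/interval_open.
Qed.

Lemma integral_cube c M K : 0 <= M -> 0 <= K ->
  (\int[lebesgue_rV R n]_x (K * \1_(cube c M) x)%:E)%E = (K * (2 * M) ^+ n)%:E.
Proof.
move=> M0 K0; have mC := measurable_cube c M.
rewrite (integralZl_indic measurableT (fun=> cube c M))//; last first.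
  by rewrite ltNge K0.
by rewrite integral_indic// setIT EFinM; congr (_ * _)%E; exact: lebesgue_cube.
Qed.

Lemma measurable_indic_cube c M K :
  measurable_fun setT (fun x : 'rV[R]_n => K * \1_(cube c M) x).
Proof.
apply: measurable_funM => //.
by apply: measurable_indic; exact: measurable_cube.
Qed.

Lemma integrable_cube f c M K : 0 <= M -> 0 <= K -> measurable_fun setT f ->
  (forall x, `|f x| <= K * \1_(cube c M) x) ->
  (lebesgue_rV R n).-integrable setT (EFin \o f).
Proof.
move=> M0 K0 mf fK; apply: (@le_integrable _ _ _ _ _ measurableT _
    (EFin \o (fun x => K * \1_(cube c M) x))) => //.
- exact/measurable_EFinP.
- by move=> x _ /=; rewrite lee_fin (le_trans (fK x))// ler_norm.
apply/integrableP; split.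
  by apply/measurable_EFinP; exact: measurable_indic_cube.
rewrite (eq_integral (fun x => (K * \1_(cube c M) x)%:E)) => [|x _ /=].
  by rewrite integral_cube// ltry.
by rewrite ger0_norm// mulr_ge0.
Qed.

End cubes.

(** * Vanishing integrals of derivatives with bounded support *)

Section divergence.
Context {R : realType}.

Lemma integral_derivative_eq0 (g d : R -> R) (c M : R) :
  (* The endpoints [a] and [b] chosen below lie one unit beyond the support bound, so that a < b
     also when M = 0 and [g] vanishes at both. *)
  (forall t : R, is_derive t 1 g (d t)) -> continuous d -> 0 <= M ->
  (forall t, M < `|t - c| -> g t = 0 /\ d t = 0) ->
  (\int[lebesgue_measure]_t (d t)%:E = 0)%E.
Proof.
move=> gd cd M0 supp; pose a := c - M - 1; pose b := c + M + 1.
have ab : a < b by rewrite /a /b; lra.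
have cg : continuous g.
  move=> t; apply: differentiable_continuous; apply/derivable1_diffP.
  by case: (gd t).
have out t : t <= a \/ b <= t -> g t = 0 /\ d t = 0.
  by rewrite /a /b => abt; apply: supp; rewrite ltr_normr; case: abt => ?;
    apply/orP; [right|left]; lra.
transitivity (\int[lebesgue_measure]_(t in `[a, b]) (d t)%:E)%E.
  rewrite [RHS]integral_mkcond; apply: eq_integral => t _.
  rewrite patchE mem_setE in_itv/=; case: ifPn => //.
  rewrite negb_and -!ltNge => abt; congr (_%:E).
  by apply: (out t _).2; case/orP: abt => /ltW; [left|right].
rewrite (@continuous_FTC2 _ d g)//.
- have [-> _] := out b (or_intror (lexx _)).
  by have [-> _] := out a (or_introl (lexx _)); rewrite subee.
- exact: continuous_subspaceT.
- split => [t _||]; first by case: (gd t).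
  + by apply: cvg_at_right_filter; exact: cg.
  + by apply: cvg_at_left_filter; exact: cg.
- by move=> t _; rewrite derive1E; case: (gd t).
Qed.

Lemma upd_cons_rV0 n t (y : 'rV[R]_n) : cons_rV (t, y) = upd ord0 (cons_rV (0, y)) t.
Proof.
apply/rowP => j; rewrite -[LHS]/(cons_rV _ ord0 j) updE; case: (unliftP ord0 j) => [k|] ->.
  by rewrite !cons_rVS.
by rewrite !cons_rV0 eqxx.
Qed.

Lemma cons_rV_upd n t s (y : 'rV[R]_n) i :
  cons_rV (t, upd i y s) = upd (lift ord0 i) (cons_rV (t, y)) s.
Proof.
apply/rowP => j; rewrite -[LHS]/(cons_rV _ ord0 j) updE; case: (unliftP ord0 j) => [k|] ->.
  by rewrite !cons_rVS/= updE (inj_eq lift_inj).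
by rewrite !cons_rV0.
Qed.

(** The induction follows the recursive construction of the measure. If [i] is the first coordinate,
    Fubini makes it the inner integral, which is zero by hypothesis; otherwise each slice at a fixed
    first coordinate falls under the induction hypothesis. *)
Lemma integral_lines_eq0 n (i : 'I_n) (f : 'rV[R]_n -> R) c M K :
  0 <= M -> 0 <= K -> measurable_fun setT f ->
  (forall x, `|f x| <= K * \1_(cube c M) x) ->
  (forall x, (\int[lebesgue_measure]_t (f (upd i x t))%:E = 0)%E) ->
  (\int[lebesgue_rV R n]_x (f x)%:E = 0)%E.
Proof.
move=> M0 K0; elim: n i f c => [[]//|n IH] i f c mf fK fi.
pose F (p : measurableTypeR R * 'rV[R]_n) := (f (cons_rV p))%:E.
have mF : measurable_fun setT F.
  by apply/measurable_EFinP; apply: measurableT_comp => //; exact: measurable_cons_rV.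
have mEf : measurable_fun setT (EFin \o f) by exact/measurable_EFinP.
have iF : (lebesgue_measure \x lebesgue_rV R n)%E.-integrable setT F.
  apply/integrableP; split => //.
  have /integrableP[_] := integrable_cube M0 K0 mf fK.
  rewrite /= /lebesgue_cons_rV ge0_integral_pushforward//.
  - exact: measurable_cons_rV.
  - by apply/measurable_EFinP; apply: measurableT_comp => //; exact: normr_measurable.
rewrite /= /lebesgue_cons_rV (integral_pushforward (measurable_cons_rV (n := n)) mEf)//.
rewrite preimage_setT -[LHS]/(\int[lebesgue_measure \x lebesgue_rV R n]_z F z)%E.
rewrite -integral12_prod_meas1//.
move: fi; have [j ->|->] := unliftP ord0 i => fi; last first.
  rewrite Fubini//; apply: integral0_eq => y _; rewrite -[RHS](fi (cons_rV (0, y))).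
  by apply: eq_integral => t _; rewrite /F upd_cons_rV0.
apply: integral0_eq => t _.
apply: (IH j (fun y => f (cons_rV (t, y))) (uncons_rV c).2) => [|y|y].
- apply: measurableT_comp => //.
  by apply: measurableT_comp; [exact: measurable_cons_rV|exact: pair1_measurable].
- apply: le_trans (fK _) _; rewrite ler_wpM2l// !indicE ler_nat.
  have [/set_mem cy|] := boolP (cons_rV (t, y) \in cube c M); last by [].
  rewrite mem_set// => k; have := cy (lift ord0 k); rewrite cons_rVS.
  by rewrite -[in c ord0 _](uncons_rVK c) cons_rVS.
- rewrite -[RHS](fi (cons_rV (t, y))).
  by apply: eq_integral => s _; rewrite cons_rV_upd.
Qed.

(** Continuity of [D] is asked only along lines parallel to axis [i]. For the radial field this
    confines the singular point to the axis itself, where the component is just the sine. *)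
Lemma integral_partial_eq0 n (i : 'I_n) (G D : 'rV[R]_n -> R) c M K :
  0 <= M -> 0 <= K -> measurable_fun setT D ->
  (forall x, `|D x| <= K * \1_(cube c M) x) ->
  (forall x, ~ cube c M x -> G x = 0) ->
  (forall x, is_derive x (delta_mx ord0 i) G (D x)) ->
  (forall x, continuous (fun t => D (upd i x t))) ->
  (\int[lebesgue_rV R n]_x (D x)%:E = 0)%E.
Proof.
move=> M0 K0 mD DK G0 GD cD; apply: (integral_lines_eq0 (i := i) M0 K0 mD DK) => x.
apply: (@integral_derivative_eq0 (fun t => G (upd i x t)) _ (c ord0 i) M) => //.
  by move=> t; exact: is_derive_upd.
move=> t Mt; have nc : ~ cube c M (upd i x t).
  by move=> /(_ i); rewrite updE eqxx leNgt Mt.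
split; first exact: G0.
apply/eqP; rewrite -normr_le0; apply: le_trans (DK _) _.
by rewrite indicE memNset// mulr0.
Qed.

End divergence.

(** * Bounds by multiples of the indicator of a cube *)

Section cube_bounds.
Context {R : realType} {n : nat}.
Implicit Types (c x : 'rV[R]_n) (M K : R) (f : 'rV[R]_n -> R).

Lemma le_indic_cube f c M K :
  (forall x, cube c M x -> `|f x| <= K) -> (forall x, ~ cube c M x -> f x = 0) ->
  forall x, `|f x| <= K * \1_(cube c M) x.
Proof.
move=> fK f0 x; rewrite indicE; have [cx|ncx] := pselect (cube c M x).
  by rewrite mem_set// mulr1 fK.
by rewrite memNset// mulr0 f0// normr0.
Qed.

Lemma compact_cube c (M : R) : compact (cube c M).
Proof.
rewrite cube_itv; apply: (@rV_compact R n (fun i => `[c ord0 i - M, c ord0 i + M]%classic)).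
by move=> i; exact: segment_compact.
Qed.

Lemma continuous_cube_bounded f c M : continuous f ->
  exists2 K, 0 <= K & forall x, cube c M x -> `|f x| <= K.
Proof.
move=> cf; have /compact_bounded[K0 [_ HK]] :=
  continuous_compact (continuous_subspaceT cf) (@compact_cube c M).
exists (`|K0| + 1) => [|x cx]; first by rewrite addr_ge0.
by apply: HK; [rewrite ltr_pwDr// ler_norm|exists x].
Qed.

End cube_bounds.

(** * Lipschitz estimates for sine and cosine *)

Section trigonometric_estimates.
Context {R : realType}.

Lemma lipschitz_of_derivative (g dg : R -> R) (a b : R) :
  (forall t : R, is_derive t 1 g (dg t)) -> (forall t, `|dg t| <= 1) ->
  `|g a - g b| <= `|a - b|.
Proof.
move=> gd dg1; wlog ab : a b / a < b => [H|].
  by have [/H//|/H|->] := ltgtP a b; [rewrite distrC [leRHS]distrC|rewrite !subrr].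
have cg t : {for t, continuous g}.
  apply: differentiable_continuous; apply/derivable1_diffP.
  by case: (gd t).
have [|c _ gba] := @MVT R g dg a b ab (fun t _ => gd t).
  by apply: continuous_subspaceT => t; exact: cg.
by rewrite distrC gba normrM [leRHS]distrC ler_piMl.
Qed.

Lemma normr_sin_le1 (t : R) : `|sin t| <= 1.
Proof. by rewrite ler_norml sin_le1 sin_geN1. Qed.

Lemma normr_cos_le1 (t : R) : `|cos t| <= 1.
Proof. by rewrite ler_norml cos_le1 cos_geN1. Qed.

Lemma cos_lipschitz (a b : R) : `|cos a - cos b| <= `|a - b|.
Proof.
apply: (lipschitz_of_derivative (dg := fun t => - sin t)) => t.
by rewrite normrN normr_sin_le1.
Qed.

Lemma normr_sin_le (t : R) : `|sin t| <= `|t|.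
Proof.
have := @lipschitz_of_derivative sin cos t 0 _ normr_cos_le1.
by rewrite sin0 !subr0; apply.
Qed.

End trigonometric_estimates.

(** * The field sin r x / r along a coordinate line *)

Section sine_field.
Context {R : realType}.

Let r (q t : R) : R := Num.sqrt (q + t ^+ 2).

(** A component of the field on a line parallel to its axis, [q] being the sum of the squares of the
    other coordinates. For q > 0 the line avoids the origin and r is smooth on it; for q = 0
    evenness of sin(s) / s removes the absolute value in r = |t|. *)
Definition sine_line (q t : R) : R := t * (sin (r q t) / r q t).

(** The value 1 at r = 0 is cos 0, the derivative of the sine there. *)
Definition sine_line_deriv (q t : R) : R :=
  if r q t == 0 then 1 else
  sin (r q t) / r q t + t ^+ 2 * (cos (r q t) / r q t ^+ 2 - sin (r q t) / r q t ^+ 3).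

Let sine_line0 : sine_line 0 = sin.
Proof.
apply/funext => t; rewrite /sine_line /r add0r sqrtr_sqr.
have [->|t0] := eqVneq t 0; first by rewrite mul0r sin0.
case: (ltgtP t 0) t0 => // t0 _.
  by rewrite ltr0_norm// sinN; field; rewrite lt_eqF.
by rewrite gtr0_norm//; field; rewrite gt_eqF.
Qed.

Let sine_line_deriv0 : sine_line_deriv 0 = cos.
Proof.
apply/funext => t; rewrite /sine_line_deriv /r add0r sqrtr_sqr normr_eq0.
have [->|t0] := eqVneq t 0; first by rewrite cos0.
case: (ltgtP t 0) t0 => // t0 _.
  by rewrite ltr0_norm// sinN cosN; field; rewrite lt_eqF.
by rewrite gtr0_norm//; field; rewrite gt_eqF.
Qed.

Lemma is_derive_sine_line (q t : R) : 0 <= q ->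
  is_derive t 1 (sine_line q) (sine_line_deriv q t).
Proof.
rewrite le_eqVlt => /predU1P[<-|q0].
  by rewrite sine_line0 sine_line_deriv0; exact: is_derive_sin.
have qt : 0 < q + t ^+ 2 by rewrite ltr_pwDl// sqr_ge0.
have r0 : 0 < r q t by rewrite sqrtr_gt0.
have dr : is_derive t 1 (r q) (t / r q t).
  have d2 : is_derive t 1 (fun t : R => q + t ^+ 2) (2 * t).
    have d := @is_deriveM _ _ id id t (1 : R) _ _ (is_derive_id t 1) (is_derive_id t 1).
    apply: (is_derive_eq (is_deriveD (is_derive_cst q t 1) d)).
    by rewrite /GRing.scale /=; ring.
  have d3 := @is_derive1_comp R Num.sqrt (fun t => q + t ^+ 2) t _ _ (is_derive1_sqrt qt) d2.
  apply: (is_derive_eq d3).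
  by rewrite -/(r q t); field; rewrite gt_eqF.
have dV := @is_deriveV R (r q) t _ _ (lt0r_neq0 r0) dr.
have ds := is_derive1_comp (is_derive_sin (r q t)) dr.
apply: (is_derive_eq (is_deriveM (is_derive_id t 1) (is_deriveM ds dV))).
rewrite /sine_line_deriv gt_eqF// /GRing.scale /=.
rewrite [X in X * 1](_ : _ = sin (r q t) / r q t)//.
by field; rewrite gt_eqF.
Qed.

Lemma continuous_sine_line_deriv q : 0 <= q -> continuous (sine_line_deriv q).
Proof.
rewrite le_eqVlt => /predU1P[<-|q0].
  by rewrite sine_line_deriv0; exact: continuous_cos.
have r0 t : 0 < r q t by rewrite sqrtr_gt0 ltr_pwDl// sqr_ge0.
have cr : continuous (Num.sqrt \o (fun t : R => q + t ^+ 2)).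
  move=> t; apply: continuous_comp.
    by apply: cvgD; [exact: cvg_cst|exact: exprn_continuous].
  exact: sqrt_continuous.
have cV : continuous (fun t => (r q t)^-1).
  by move=> t; apply: cvgV; [rewrite gt_eqF|exact: cr].
have cs : continuous (fun t => sin (r q t)).
  by move=> t; apply: continuous_comp; [exact: cr|exact: continuous_sin].
have cc : continuous (fun t => cos (r q t)).
  by move=> t; apply: continuous_comp; [exact: cr|exact: continuous_cos].
rewrite (_ : sine_line_deriv q = fun t => sin (r q t) * (r q t)^-1 +
    t ^+ 2 * (cos (r q t) * ((r q t)^-1) ^+ 2 - sin (r q t) * ((r q t)^-1) ^+ 3)).
  have cX k : continuous (fun t => (r q t)^-1 ^+ k).
    move=> t; apply: (@continuous_comp _ _ _ (fun t => (r q t)^-1) (fun u => u ^+ k)).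
      exact: cV.
    exact: exprn_continuous.
  move=> t; apply: cvgD; first by apply: cvgM; [exact: cs|exact: cV].
  apply: cvgM; first exact: exprn_continuous.
  by apply: cvgB; apply: cvgM; [exact: cc|exact: cX|exact: cs|exact: cX].
by apply/funext => t; rewrite /sine_line_deriv gt_eqF// !exprVn.
Qed.

End sine_field.

(** * The radial field, its divergence and [sigma_potential] *)

Section radial_field.
Context {R : realType} {n : nat}.
Implicit Types (x : 'rV[R]_n) (i : 'I_n).

Lemma sqnorm_rV_ge0 x : 0 <= sqnorm_rV x.
Proof. by apply: sumr_ge0 => i _; exact: sqr_ge0. Qed.

Lemma enorm_ge0 x : 0 <= enorm x. Proof. exact: sqrtr_ge0. Qed.

Lemma sqr_enorm x : enorm x ^+ 2 = sqnorm_rV x.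
Proof. by rewrite sqr_sqrtr// sqnorm_rV_ge0. Qed.

Lemma normr_le_enorm x i : `|x ord0 i| <= enorm x.
Proof.
rewrite -(ler_pXn2r (isT : (0 < 2)%N)) ?nnegrE ?enorm_ge0// sqr_enorm.
rewrite real_normK ?num_real// /sqnorm_rV (bigD1 i)//= lerDl.
by apply: sumr_ge0 => j _; exact: sqr_ge0.
Qed.

Lemma sqnorm_upd i x t :
  sqnorm_rV (upd i x t) = \sum_(j | j != i) x ord0 j ^+ 2 + t ^+ 2.
Proof.
rewrite /sqnorm_rV (bigD1 i)//= updE eqxx addrC; congr (_ + _).
by apply: eq_bigr => j /negbTE ji; rewrite updE ji.
Qed.

Lemma measurable_coord i : measurable_fun setT (fun x : 'rV[R]_n => x ord0 i).
Proof. exact: measurable_coord_rV. Qed.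

Lemma measurable_sqnorm d (T : measurableType d) (f : T -> 'rV[R]_n) :
  measurable_fun setT f -> measurable_fun setT (fun t => sqnorm_rV (f t)).
Proof.
move=> /measurable_fun_rVP mf; apply: measurable_sum => i.
by apply: measurable_funX; exact: mf.
Qed.

Lemma measurable_enorm : measurable_fun setT (@enorm R n).
Proof.
rewrite (_ : @enorm R n = Num.sqrt \o @sqnorm_rV R n)//.
apply: measurableT_comp; last exact: measurable_sqnorm.
by apply: continuous_measurable_fun; exact: sqrt_continuous.
Qed.

Lemma measurable_enormV : measurable_fun setT (fun x : 'rV[R]_n => (enorm x)^-1).
Proof.
(* The inverse is discontinuous at 0; on nonnegative reals it agrees with the power of exponent -1,
   also at 0, and that power is measurable. *)
rewrite (_ : (fun x => _) = (@powR R ^~ (-1)) \o @enorm R n).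
  by apply: measurableT_comp; [exact: measurable_powR|exact: measurable_enorm].
by apply/funext => x /=; rewrite powR_inv1// enorm_ge0.
Qed.

Lemma measurable_sin_enorm : measurable_fun setT (fun x : 'rV[R]_n => sin (enorm x)).
Proof.
apply: measurableT_comp measurable_enorm.
by apply: continuous_measurable_fun; exact: continuous_sin.
Qed.

Lemma measurable_cos_enorm : measurable_fun setT (fun x : 'rV[R]_n => cos (enorm x)).
Proof.
apply: measurableT_comp measurable_enorm.
by apply: continuous_measurable_fun; exact: continuous_cos.
Qed.

Lemma measurable_sigma_potential : measurable_fun setT (@sigma_potential R n).
Proof.
apply: measurable_funB; last exact: measurable_funX measurable_sin_enorm.
apply: measurable_funD; first exact: measurable_cos_enorm.
apply: measurable_funM measurable_sin_enorm.
by apply: measurable_funM measurable_enormV; exact: measurable_cst.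
Qed.

Definition sine_field i x : R := x ord0 i * (sin (enorm x) / enorm x).

Definition sine_field_deriv i x : R :=
  if enorm x == 0 then 1 else
  sin (enorm x) / enorm x +
  x ord0 i ^+ 2 * (cos (enorm x) / enorm x ^+ 2 - sin (enorm x) / enorm x ^+ 3).

Let q i x : R := \sum_(j | j != i) x ord0 j ^+ 2.

Let q_ge0 i x : 0 <= q i x.
Proof. by apply: sumr_ge0 => j _; exact: sqr_ge0. Qed.

Lemma sine_field_upd i x t : sine_field i (upd i x t) = sine_line (q i x) t.
Proof. by rewrite /sine_field /enorm sqnorm_upd updE eqxx. Qed.

Lemma sine_field_deriv_upd i x t :
  sine_field_deriv i (upd i x t) = sine_line_deriv (q i x) t.
Proof. by rewrite /sine_field_deriv /enorm sqnorm_upd updE eqxx. Qed.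

Lemma is_derive_sine_field i x :
  is_derive x (delta_mx ord0 i) (sine_field i) (sine_field_deriv i x).
Proof.
apply: is_derive_of_line; rewrite -[X in sine_field_deriv i X](upd_id i x) sine_field_deriv_upd.
rewrite (_ : (fun t => _) = sine_line (q i x)).
  exact: is_derive_sine_line.
by apply/funext => t; exact: sine_field_upd.
Qed.

Lemma continuous_sine_field_deriv_upd i x :
  continuous (fun t => sine_field_deriv i (upd i x t)).
Proof.
rewrite (_ : (fun t => _) = sine_line_deriv (q i x)).
  exact: continuous_sine_line_deriv.
by apply/funext => t; exact: sine_field_deriv_upd.
Qed.

Lemma continuous_sine_field_upd i x : continuous (fun t => sine_field i (upd i x t)).
Proof.
rewrite (_ : (fun t => _) = sine_line (q i x)).
  move=> t; apply: differentiable_continuous; apply/derivable1_diffP.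
  by case: (is_derive_sine_line t (q_ge0 i x)).
by apply/funext => t; exact: sine_field_upd.
Qed.

Lemma measurable_sine_field i : measurable_fun setT (sine_field i).
Proof.
apply: measurable_funM; first exact: measurable_coord.
by apply: measurable_funM; [exact: measurable_sin_enorm|exact: measurable_enormV].
Qed.

Lemma measurable_sine_field_deriv i : measurable_fun setT (sine_field_deriv i).
Proof.
apply: measurable_fun_ifT.
- by apply: measurable_fun_eqr; [exact: measurable_enorm|exact: measurable_cst].
- exact: measurable_cst.
rewrite (_ : (fun x => _) = fun x => sin (enorm x) * (enorm x)^-1 + x ord0 i ^+ 2 *
  (cos (enorm x) * (enorm x)^-1 ^+ 2 - sin (enorm x) * (enorm x)^-1 ^+ 3)).
  have mV k := measurable_funX k measurable_enormV.
  have [ms mc] := (measurable_sin_enorm, measurable_cos_enorm).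
  apply: measurable_funD; first exact: measurable_funM ms measurable_enormV.
  apply: measurable_funM; first by apply: measurable_funX; exact: measurable_coord.
  by apply: measurable_funB; [exact: measurable_funM mc (mV _)|exact: measurable_funM ms (mV _)].
by apply/funext => x; rewrite !exprVn.
Qed.

Lemma normr_sinc_le1 (t : R) : `|sin t / t| <= 1.
Proof.
have [->|t0] := eqVneq t 0; first by rewrite invr0 mulr0 normr0.
by rewrite normrM normfV ler_pdivrMr ?normr_gt0// mul1r normr_sin_le.
Qed.

Lemma normr_sine_field_le1 i x : `|sine_field i x| <= 1.
Proof.
have [x0|x0] := eqVneq (enorm x) 0.
  by rewrite /sine_field x0 invr0 !mulr0 normr0.
have r0 : 0 < enorm x by rewrite lt_def x0 enorm_ge0.
rewrite /sine_field mulrCA normrM -[leRHS](mulr1 1) ler_pM ?normr_sin_le1//.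
by rewrite normrM normfV (ger0_norm (enorm_ge0 x)) ler_pdivrMr// mul1r normr_le_enorm.
Qed.

Lemma normr_sine_field_deriv_le3 i x : `|sine_field_deriv i x| <= 3.
Proof.
rewrite /sine_field_deriv; have [x0|x0] := eqVneq (enorm x) 0.
  by rewrite normr1 ler1n.
have r0 : 0 < enorm x by rewrite lt_def x0 enorm_ge0.
have xr : `|x ord0 i ^+ 2 / enorm x ^+ 2| <= 1.
  rewrite -expr_div_n normrX exprn_ile1// normrM normfV (ger0_norm (enorm_ge0 x)).
  by rewrite ler_pdivrMr// mul1r normr_le_enorm.
rewrite (_ : 3 = 1 + 1 * (1 + 1)); last by ring.
rewrite (le_trans (ler_normD _ _))// lerD ?normr_sinc_le1//.
(* Regrouped so that every negative power of r is matched: x_i / r and sin r / r are at most 1 in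
   absolute value. *)
rewrite (_ : x ord0 i ^+ 2 * _ =
  x ord0 i ^+ 2 / enorm x ^+ 2 * (cos (enorm x) - sin (enorm x) / enorm x)); last by field.
rewrite normrM ler_pM// (le_trans (ler_normB _ _))// lerD ?normr_cos_le1//.
exact: normr_sinc_le1.
Qed.

Lemma sum_sqr_sine_field x : \sum_i sine_field i x ^+ 2 = sin (enorm x) ^+ 2.
Proof.
under eq_bigr do rewrite exprMn.
rewrite -mulr_suml -/(sqnorm_rV x) -sqr_enorm.
have [->|x0] := eqVneq (enorm x) 0; first by rewrite sin0; ring.
by field.
Qed.

Lemma sum_sine_field_deriv x : enorm x != 0 ->
  \sum_i sine_field_deriv i x =
  cos (enorm x) + (n%:R - 1) / enorm x * sin (enorm x).
Proof.
move=> x0; rewrite /sine_field_deriv (negbTE x0) big_split/= sumr_const card_ord.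
rewrite -mulr_suml -/(sqnorm_rV x) -sqr_enorm -mulr_natl.
by field.
Qed.

(** Off the origin this is the equality sigma = div F - |F|^2. At the origin the convention for
    division by zero leaves sigma = 1, while div F = n, so the inequality holds at every point and
    no null set has to be removed. *)
Lemma sigma_potential_le x : (0 < n)%N ->
  sigma_potential x <= \sum_i sine_field_deriv i x - \sum_i sine_field i x ^+ 2.
Proof.
move=> n0; rewrite sum_sqr_sine_field /sigma_potential lerD2r.
have [x0|x0] := eqVneq (enorm x) 0; last by rewrite sum_sine_field_deriv.
rewrite x0 sin0 cos0 mulr0 addr0 (eq_bigr (fun=> 1)) => [|i _].
  by rewrite sumr_const card_ord ler1n.
by rewrite /sine_field_deriv x0 eqxx.
Qed.

Lemma normr_sigma_potential_le x : `|sigma_potential x| <= n%:R + 3.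
Proof.
rewrite /sigma_potential (le_trans (ler_normB _ _))//.
rewrite (_ : n%:R + 3 = 1 + (n%:R + 1) * 1 + 1); last by ring.
apply: lerD; last by rewrite normrX exprn_ile1// normr_sin_le1.
rewrite (le_trans (ler_normD _ _))// lerD ?normr_cos_le1//.
rewrite -mulrA [_^-1 * _]mulrC normrM ler_pM// ?normr_sinc_le1//.
by rewrite (le_trans (ler_normB _ _))// normr_nat normr1.
Qed.

End radial_field.

(** * The form bound *)

Section upper_bound.
Context {R : realType} {n : nat}.
Implicit Types (h : 'rV[R]_n -> R).

(* [div (F h^2) + |grad h|^2 - (div F - |F|^2) h^2 = |grad h + h F|^2] *)
Lemma sigma_potential_sqr_le h x : (0 < n)%N ->
  sigma_potential x * h x ^+ 2 <=
  \sum_i (sine_field_deriv i x * h x ^+ 2 + sine_field i x * (2 * h x * partial i h x)) +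
  sqnorm_rV (gradient h x).
Proof.
move=> n0; apply: le_trans (ler_wpM2r (sqr_ge0 _) (sigma_potential_le x n0)) _.
rewrite /sqnorm_rV -!sumrB -big_split/= mulr_suml; apply: ler_sum => i _.
rewrite mxE -subr_ge0 (_ : _ - _ = (partial i h x + sine_field i x * h x) ^+ 2).
  exact: sqr_ge0.
by ring.
Qed.

Lemma test_function_bounded h : test_function h -> exists M K, [/\ 0 <= M, 0 <= K,
  forall x, ~ cube 0 M x -> h x = 0 /\ forall i, partial i h x = 0 &
  forall x, cube 0 M x -> `|h x| <= K /\ forall i, `|partial i h x| <= K].
Proof.
move=> Th; have [sh _] := Th; have [M M0 supp] := test_function_support Th.
have [K0 K00 hK] := continuous_cube_bounded 0 M (smooth_continuous sh).
have pK i := continuous_cube_bounded 0 M (@smooth_partial_continuous _ _ _ i sh).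
pose K i := s2val (cid2 (pK i)).
have K_ge0 i : 0 <= K i by rewrite /K; case: cid2.
exists M, (K0 + \sum_i K i); split; first exact: ltW.
- by rewrite addr_ge0// sumr_ge0.
- move=> x nc; apply: supp => xM; apply: nc => i.
  by rewrite mxE subr0; exact: xM.
- move=> x cx; split; first by rewrite (le_trans (hK x cx))// lerDl sumr_ge0.
  move=> i; have Ki : `|partial i h x| <= K i by rewrite /K; case: cid2 => ? ? /=; exact.
  apply: le_trans Ki _; rewrite (bigD1 i)//= addrCA lerDl.
  by rewrite addr_ge0// sumr_ge0.
Qed.

Theorem sigma_potential_form_le h : (0 < n)%N -> test_function h ->
  (distr_of_fun sigma_potential (fun x => (h x ^+ 2)%R) <= dirichlet h)%E.
Proof.
move=> n0 Th; have [sh _] := Th.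
have [M [K [M0 K0 supp hK]]] := test_function_bounded Th.
have mh : measurable_fun setT h.
  by apply: continuous_measurable_rV; exact: smooth_continuous.
have mp i : measurable_fun setT (partial i h).
  by apply: continuous_measurable_rV; exact: smooth_partial_continuous.
have mg : measurable_fun setT (fun x => sqnorm_rV (gradient h x)).
  apply: measurable_sqnorm; apply/measurable_fun_rVP => i.
  rewrite (_ : _ \o _ = partial i h); first exact: mp.
  by apply/funext => x; rewrite /coord_rV /= mxE.
(* [D i] is the derivative along axis [i] of F_i h^2, so the sum over [i] is div (F h^2). *)
pose D i x := sine_field_deriv i x * h x ^+ 2 + sine_field i x * (2 * h x * partial i h x).
have mD i : measurable_fun setT (D i).
  apply: measurable_funD; apply: measurable_funM.
  - exact: measurable_sine_field_deriv.
  - exact: measurable_funX.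
  - exact: measurable_sine_field.
  - by apply: measurable_funM => //; apply: measurable_funM => //; exact: measurable_cst.
have DK i x : `|D i x| <= (5 * K ^+ 2) * \1_(cube 0 M) x.
  apply: le_indic_cube x => x cx; last first.
    by rewrite /D; have [-> ->] := supp x cx; ring.
  have [hKx pKx] := hK x cx.
  rewrite (_ : 5 * K ^+ 2 = 3 * K ^+ 2 + 1 * (2 * K * K)); last by ring.
  rewrite (le_trans (ler_normD _ _))// lerD// normrM ler_pM//.
  - exact: normr_sine_field_deriv_le3.
  - by rewrite normrX ler_pXn2r// nnegrE.
  - exact: normr_sine_field_le1.
  - by rewrite normrM ler_pM// normrM ger0_norm// ler_wpM2l.
have K5 : 0 <= 5 * K ^+ 2 by rewrite mulr_ge0// sqr_ge0.
have ID i : (\int[lebesgue_rV R n]_x (D i x)%:E = 0)%E.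
  apply: (integral_partial_eq0 (i := i) (G := fun x => sine_field i x * (h x * h x)) M0 K5) => //.
  - by move=> x nc; have [-> _] := supp x nc; rewrite mul0r mulr0.
  - move=> x; have dh := smooth_is_derive i x sh.
    apply: (is_derive_eq (is_deriveM (is_derive_sine_field i x) (is_deriveM dh dh))).
    by rewrite /D /GRing.scale/= -[(h * h) x]/(h x * h x); ring.
  - move=> x t; rewrite /D.
    have cu f : continuous f -> {for t, continuous (fun t : R => f (upd i x t) : R)}.
      by move=> cf; apply: continuous_comp; [exact: continuous_upd|exact: cf].
    have cth := cu _ (smooth_continuous sh).
    have ctp := cu _ (@smooth_partial_continuous _ _ _ i sh).
    apply: cvgD; apply: cvgM.
    + exact: continuous_sine_field_deriv_upd.
    + exact: (cvgM cth cth).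
    + exact: continuous_sine_field_upd.
    + by apply: cvgM ctp; apply: cvgM cth; exact: cvg_cst.
have iD i : (lebesgue_rV R n).-integrable setT (EFin \o D i).
  exact: integrable_cube M0 K5 (mD i) (DK i).
have ig : (lebesgue_rV R n).-integrable setT (EFin \o (fun x => sqnorm_rV (gradient h x))).
  apply: (@integrable_cube _ _ _ 0 M (n%:R * K ^+ 2)) => //.
    by rewrite mulr_ge0// sqr_ge0.
  apply: le_indic_cube => x cx.
    have [_ pKx] := hK x cx; rewrite ger0_norm ?sqnorm_rV_ge0//.
    rewrite mulr_natl -[in leRHS](card_ord n) -sumr_const ler_sum// => i _.
    by rewrite mxE -real_normK ?num_real// ler_pXn2r// nnegrE.
  have [_ p0] := supp x cx; apply: big1 => i _.
  by rewrite mxE p0 expr0n.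
have is_ : (lebesgue_rV R n).-integrable setT (EFin \o (fun x => sigma_potential x * h x ^+ 2)).
  apply: (@integrable_cube _ _ _ 0 M ((n%:R + 3) * K ^+ 2)) => //.
  - by rewrite mulr_ge0 ?addr_ge0// sqr_ge0.
  - by apply: measurable_funM; [exact: measurable_sigma_potential|exact: measurable_funX].
  apply: le_indic_cube => x cx; last by have [-> _] := supp x cx; ring.
  have [hKx _] := hK x cx; rewrite normrM ler_pM ?normr_sigma_potential_le//.
  by rewrite normrX ler_pXn2r// nnegrE.
have isum : (lebesgue_rV R n).-integrable setT (fun x => \sum_i (D i x)%:E)%E.
  by apply: (integrable_sum measurableT) => i _; exact: iD.
rewrite /distr_of_fun /dirichlet.
(* The pointwise inequality is integrated with div (F h^2) still present; splitting the integral
   then removes it term by term. *)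
apply: (@le_trans _ _ (\int[lebesgue_rV R n]_x
    (\sum_i (D i x)%:E + (sqnorm_rV (gradient h x))%:E))%E).
  apply: le_integral => //.
    by apply: integrableD.
  move=> x _ /=; rewrite sumEFin -EFinD lee_fin.
  exact: sigma_potential_sqr_le.
rewrite integralD//.
rewrite integral_sum// big1 ?add0e// => i _; exact: ID.
Qed.

End upper_bound.

(** * Smooth cutoffs of cubes *)

Section cutoff.
Context {R : realType}.
Implicit Types (s a t : R).

Let f : R -> R := flat 1.

Let fk (m : nat) : R -> R := flat (iter m flat_next 1).

Lemma flat1_ge0 t : 0 <= flat 1 t.
Proof. by rewrite /flat; case: ifP => // _; rewrite hornerC mul1r expR_ge0. Qed.

Lemma flat1_le1 t : flat 1 t <= 1.
Proof.
rewrite /flat; case: ifP => // t0; rewrite hornerC mul1r -expR0 ler_expR.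
by rewrite oppr_le0 invr_ge0 ltW.
Qed.

Lemma flat1_lower t : 1 / 2 <= t -> expR (- 2) <= flat 1 t.
Proof.
move=> t2; have t0 : 0 < t by rewrite (lt_le_trans _ t2).
rewrite flat_gt0// hornerC mul1r ler_expR lerN2 invf_ple ?posrE//.
by rewrite -[2^-1]div1r.
Qed.

(** The derivative of order [m] of t |-> flat 1 (1 + s (t - a)), in the form that [Ck_coord]
    takes. *)
Let fk_affine s a m t := s ^+ m * fk m (1 + s * (t - a)).

Lemma is_derive_flat_affine p s a t :
  is_derive t 1 (fun t => flat p (1 + s * (t - a)))
    (s * flat (flat_next p) (1 + s * (t - a))).
Proof.
have d : is_derive t 1 (fun t => 1 + s * (t - a)) s.
  have d1 := is_deriveB (is_derive_id t (1 : R)) (is_derive_cst a t (1 : R)).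
  have d2 := is_deriveM (is_derive_cst s t (1 : R)) d1.
  apply: (is_derive_eq (is_deriveD (is_derive_cst (1 : R) t (1 : R)) d2)).
  by rewrite /GRing.scale/=; ring.
have := @is_derive1_comp R (flat p) _ t _ _ (is_derive_flat p (1 + s * (t - a))) d.
by rewrite mulrC.
Qed.

Let is_derive_fk_affine s a m t :
  is_derive t 1 (fk_affine s a m) (fk_affine s a m.+1 t).
Proof.
have d := is_derive_flat_affine (iter m flat_next 1) s a t.
apply: (is_derive_eq (is_deriveM (is_derive_cst (s ^+ m) t (1 : R)) d)).
by rewrite /GRing.scale/= /fk_affine exprSr /fk iterS; ring.
Qed.

Context {n : nat}.
Implicit Types (c x : 'rV[R]_n).

Let e s a t := f (1 + s * (t - a)) * f (1 + - s * (t - a)).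

Let e' s a t := s * fk 1 (1 + s * (t - a)) * f (1 + - s * (t - a)) -
                s * f (1 + s * (t - a)) * fk 1 (1 + - s * (t - a)).

Let is_derive_e s a t : is_derive t 1 (e s a) (e' s a t).
Proof.
have d1 := is_derive_flat_affine 1 s a t.
have d2 := is_derive_flat_affine 1 (- s) a t.
apply: (is_derive_eq (is_deriveM d1 d2)).
by rewrite /GRing.scale/= /e' /f /fk /=; ring.
Qed.

(** Each of the 2n factors vanishes beyond one face of the cube of half-side 1/s. The function is
    not normalised to be 1 in the middle: a positive lower bound on the half-size cube, independent
    of [c] and [s], is enough. *)
Definition cutoff c s x : R :=
  \prod_i (flat 1 (1 + s * (x ord0 i - c ord0 i)) *
           flat 1 (1 + - s * (x ord0 i - c ord0 i))).

Lemma smooth_cutoff c s : smooth (cutoff c s).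
Proof.
move=> k; apply: Ck_prod => i.
have Cf s' : Ck k (fun x => f (1 + s' * (x ord0 i - c ord0 i))).
  have := @Ck_coord R n k _ 0%N i (is_derive_fk_affine s' (c ord0 i)).
  by under eq_fun do rewrite /fk_affine expr0 mul1r.
by apply: CkM; exact: Cf.
Qed.

Let e_ge0 s a t : 0 <= e s a t.
Proof. by rewrite mulr_ge0// flat1_ge0. Qed.

Let e_le1 s a t : e s a t <= 1.
Proof. by rewrite mulr_ile1 ?flat1_ge0 ?flat1_le1. Qed.

Let one_side s a t : 0 < s -> s^-1 < `|t - a| ->
  1 + s * (t - a) <= 0 \/ 1 + - s * (t - a) <= 0.
Proof.
move=> s0; rewrite ltr_normr => /orP[] sta; [right|left].
  by rewrite mulNr subr_le0 -ler_pdivrMl// mulr1 ltW.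
rewrite -[s * _]opprK -mulrN subr_le0 -ler_pdivrMl// mulr1.
exact: ltW.
Qed.

Lemma cutoff_ge0 c s x : 0 <= cutoff c s x.
Proof. by apply: prodr_ge0 => i _; exact: e_ge0. Qed.

Lemma cutoff_le1 c s x : cutoff c s x <= 1.
Proof. by apply: prodr_ile1 => i; rewrite e_ge0 e_le1. Qed.

Lemma cutoff_eq0 c s x : 0 < s -> ~ cube c s^-1 x -> cutoff c s x = 0.
Proof.
move=> s0 /existsNP[i /negP]; rewrite -ltNge => /(one_side s0) H.
apply/eqP/prodf_eq0; exists i => //; rewrite mulf_eq0.
by apply/orP; case: H => H; [left|right]; rewrite flat_le0.
Qed.

(** On the half-size cube both arguments 1 + s (x_i - c_i) and 1 - s (x_i - c_i) are at least 1/2,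
    where exp(-1/t) >= exp(-2). *)
Lemma cutoff_lower c s x : 0 < s -> cube c (s^-1 / 2) x ->
  (expR (- 2) * expR (- 2)) ^+ n <= cutoff c s x.
Proof.
move=> s0 cx; rewrite -[in leLHS](card_ord n) -prodr_const.
apply: ler_prod => i _; rewrite mulr_ge0 ?expR_ge0//=.
have H : `|s * (x ord0 i - c ord0 i)| <= 1 / 2.
  by rewrite normrM gtr0_norm// mulrC -ler_pdivlMr// mulrC mulrA mulr1; exact: cx.
move: H; rewrite ler_norml => /andP[H1 H2].
by apply: ler_pM; rewrite ?expR_ge0//; apply: flat1_lower; [|rewrite mulNr]; lra.
Qed.

Let partial_cutoff c s i x : partial i (cutoff c s) x =
  e' s (c ord0 i) (x ord0 i) *
  \prod_(j | j != i) e s (c ord0 j) (x ord0 j).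
Proof.
apply: derive_val; apply: is_derive_of_line.
set P := \prod_(j | _) _.
rewrite (_ : (fun t => _) = e s (c ord0 i) * cst P); last first.
  apply/funext => t; rewrite /cutoff (bigD1 i)//= updE eqxx; congr (_ * _).
  by apply: eq_bigr => j /negbTE ji; rewrite updE ji.
apply: (is_derive_eq (is_deriveM (is_derive_e _ _ _) (is_derive_cst P (x ord0 i) (1 : R)))).
by rewrite /GRing.scale/= mulr0 add0r mulrC.
Qed.

(** The factor s comes from the chain rule and the rest from a bound on the derivative of [flat 1],
    doubled for the two factors in x_i. Hence one [K] serves all centres and scales, which allows L
    to grow later. *)
Lemma normr_partial_cutoff : exists2 K, 0 <= K &
  forall c s i x, 0 < s ->
    `|partial i (cutoff c s) x| <= (K * s) * \1_(cube c s^-1) x.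
Proof.
have [K K0 HK] := flat_bounded (flat_next 1 : {poly R}).
exists (2 * K) => [|c s i x s0]; first by rewrite mulr_ge0.
apply: le_indic_cube x => x cx; rewrite partial_cutoff.
  rewrite normrM -[leRHS]mulr1 ler_pM//; last first.
    rewrite ger0_norm; first by apply: prodr_ile1 => j; rewrite e_ge0 e_le1.
    by apply: prodr_ge0 => j _; exact: e_ge0.
  rewrite (_ : 2 * K * s = s * K * 1 + s * 1 * K); last by ring.
  rewrite (le_trans (ler_normB _ _))// lerD// !normrM gtr0_norm//.
    apply: ler_pM => //; rewrite ?mulr_ge0 ?(ltW s0)//; last first.
      by rewrite ger0_norm ?flat1_ge0 ?flat1_le1.
    by rewrite ler_wpM2l ?(ltW s0)//; exact: HK.
  apply: ler_pM => //; rewrite ?mulr_ge0 ?(ltW s0)//; last exact: HK.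
  by rewrite ler_wpM2l ?(ltW s0)// ger0_norm ?flat1_ge0 ?flat1_le1.
move/existsNP: cx => [j /negP]; rewrite -ltNge => /(one_side s0) H.
(* Beyond a face across axis [i], the vanishing factor and its derivative are both zero; beyond any
   other face, an undifferentiated factor is zero. *)
have [ji|ji] := eqVneq j i.
  rewrite -{1}ji in H *; rewrite /e' /f /fk ji in H *.
  by case: H => H; rewrite (flat_le0 1 H) (flat_le0 _ H); ring.
suff -> : \prod_(j | j != i) e s (c ord0 j) (x ord0 j) = 0 by rewrite mulr0.
apply/eqP/prodf_eq0; exists j => //; rewrite mulf_eq0.
by apply/orP; case: H => H; [left|right]; rewrite /f flat_le0.
Qed.

End cutoff.

(** * Compact support, and smoothness of the cosine of a coordinate *)

Section compact_support.
Context {R : realType} {n : nat}.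
Implicit Types (c x : 'rV[R]_n) (h : 'rV[R]_n -> R).

Lemma test_function_cube h c M : smooth h -> (forall x, ~ cube c M x -> h x = 0) ->
  test_function h.
Proof.
move=> sh h0; split => //.
apply: subclosed_compact (@closed_closure _ _) (@compact_cube _ _ c M) _.
have cC : closed (cube c M).
  by apply: compact_closed; [exact: norm_hausdorff|exact: compact_cube].
rewrite [X in _ `<=` X](closure_id _).1//; apply: closure_subset => x /= hx.
by apply: contrapT => /h0 hx0; rewrite hx0 eqxx in hx.
Qed.

(** Shifts by quarter periods put all derivatives of the cosine into one sequence, as [Ck_coord]
    requires. *)
Lemma is_derive_cos_shift (m : nat) (t : R) :
  is_derive t 1 (fun t => cos (t + m%:R * (pi / 2))) (cos (t + m.+1%:R * (pi / 2))).
Proof.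
have d := is_deriveD (is_derive_id t (1 : R)) (is_derive_cst (m%:R * (pi / 2)) t (1 : R)).
have := @is_derive1_comp R cos _ t _ _ (is_derive_cos (t + m%:R * (pi / 2))) d.
rewrite addr0 mulr1 -cosDpihalf -addrA => dc.
apply: (is_derive_eq dc); congr (cos (_ + _)).
by rewrite [in RHS]mulrS; ring.
Qed.

Lemma smooth_cos_coord i : smooth (fun x : 'rV[R]_n => cos (x ord0 i)).
Proof.
move=> k; have := @Ck_coord R n k _ 0%N i is_derive_cos_shift.
by under eq_fun do rewrite mul0r addr0.
Qed.

End compact_support.

(** * The mean of the weighted potential over a period *)

Section averaging.
Context {R : realType}.
Implicit Types t : R.

(* [(cos t - sin^2 t) (1 + cos t)^2 = 3/8 + (primitive t)'] *)
Definition primitive t : R :=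
  sin t * (1 + 11 / 8 * cos t + cos t ^+ 2 + 1 / 4 * cos t ^+ 3).

(** In powers of the cosine the product is -1 - cos + 2 cos^2 + 3 cos^3 + cos^4, whose mean is -1 +
    1 + 3/8. *)
Lemma is_derive_primitive t : is_derive t 1 primitive
  ((cos t - sin t ^+ 2) * (1 + cos t) ^+ 2 - 3 / 8).
Proof.
have ds := is_derive_sin t; have dc := is_derive_cos t.
have dc2 := is_deriveM dc dc; have dc3 := is_deriveM dc dc2.
have d1 := is_deriveD (is_derive_cst (1 : R) t (1 : R)) (is_deriveZ (11 / 8) dc).
have d2 := is_deriveD (is_deriveD d1 dc2) (is_deriveZ (1 / 4) dc3).
apply: (is_derive_eq (is_deriveM ds d2)).
rewrite /GRing.scale/=.
set A := (_ + _ + _ + _) t; set B := (cos * cos) t.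
have -> : A = 1 + 11 / 8 * cos t + cos t ^+ 2 + 1 / 4 * cos t ^+ 3 by [].
have -> : B = cos t ^+ 2 by [].
rewrite [LHS](_ : _ = - sin t ^+ 2 * (11 / 8 + 2 * cos t + 3 / 4 * cos t ^+ 2) +
  (1 + 11 / 8 * cos t + cos t ^+ 2 + 1 / 4 * cos t ^+ 3) * cos t); last by field.
have -> : sin t ^+ 2 = 1 - cos t ^+ 2 by rewrite -(cos2Dsin2 t) addrAC subrr add0r.
by field.
Qed.

Lemma normr_primitive_le4 t : `|primitive t| <= 4.
Proof.
rewrite /primitive -[leRHS]mul1r normrM ler_pM ?normr_sin_le1//.
have c1 := normr_cos_le1 t.
have c2 : `|cos t ^+ 2| <= 1 by rewrite normrX exprn_ile1.
have c3 : `|cos t ^+ 3| <= 1 by rewrite normrX exprn_ile1.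
move: c1 c2 c3; rewrite !ler_norml => /andP[? ?] /andP[? ?] /andP[? ?].
by apply/andP; split; lra.
Qed.

End averaging.

(** * Cubes far out on the first axis *)

Section far_cubes.
Context {R : realType} {N : nat}.
Let n := N.+1.
Implicit Types (x : 'rV[R]_n) (L : R).

(* The cube of half-side [L] is so far out that [|x|] differs from the first
   coordinate of [x] by at most [1 / L] on it. *)
Definition far_center L : 'rV[R]_n :=
  \row_j (if j == ord0 then L + n%:R * L ^+ 3 else 0).

Lemma far_cube_coord0 L x : cube (far_center L) L x -> n%:R * L ^+ 3 <= x ord0 ord0.
Proof.
move=> /(_ ord0); rewrite mxE eqxx ler_norml => /andP[xL _].
by lra.
Qed.

(** The other coordinates contribute at most n L^2 to r^2 - x_0^2 = (r - x_0) (r + x_0), and r + x_0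
    >= n L^3; this is why the centre lies at a distance of order L^3. *)
Lemma enorm_far_cube L x : 1 <= L -> cube (far_center L) L x ->
  n%:R * L ^+ 3 <= enorm x /\ `|enorm x - x ord0 ord0| <= 1 / L.
Proof.
move=> L1 cx; have L0 : 0 < L by exact: lt_le_trans L1.
have x0 := far_cube_coord0 cx.
have nL : 0 < n%:R * L ^+ 3 by rewrite mulr_gt0 ?ltr0n ?exprn_gt0.
have xr : x ord0 ord0 <= enorm x by rewrite (le_trans (ler_norm _))// normr_le_enorm.
split; first exact: le_trans xr.
rewrite ger0_norm ?subr_ge0//.
have H : enorm x ^+ 2 - x ord0 ord0 ^+ 2 <= n%:R * L ^+ 2.
  rewrite sqr_enorm /sqnorm_rV (bigD1 ord0)//= addrAC subrr add0r.
  apply: (@le_trans _ _ (\sum_(i < n | i != ord0) L ^+ 2)).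
    apply: ler_sum => i /negbTE i0; have := cx i; rewrite mxE i0 subr0 => xL.
    by rewrite -real_normK ?num_real// ler_pXn2r// nnegrE// ltW.
  rewrite sumr_const mulr_natl; apply: ler_wpMn2l; first exact: sqr_ge0.
  by rewrite (leq_trans (max_card _))// card_ord.
rewrite -(ler_pM2r nL) (@le_trans _ _ (n%:R * L ^+ 2))//; last first.
  by rewrite le_eqVlt; apply/orP; left; apply/eqP; field; rewrite gt_eqF.
apply: le_trans H; rewrite subr_sqr ler_wpM2l ?subr_ge0//.
by rewrite (le_trans x0)// lerDr enorm_ge0.
Qed.

(** Of the 4 / L, one part is the change in cos, one the term (n - 1) sin r / r, and two the change
    in sin^2, which is controlled as that of cos^2. *)
Lemma sigma_potential_far_cube L x : 1 <= L -> cube (far_center L) L x ->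
  `|sigma_potential x - (cos (x ord0 ord0) - sin (x ord0 ord0) ^+ 2)| <= 4 / L.
Proof.
move=> L1 cx; have L0 : 0 < L by exact: lt_le_trans L1.
have [nr rx] := enorm_far_cube L1 cx.
rewrite /sigma_potential; set r := enorm x in nr rx *; set u := x ord0 ord0 in rx *.
have cru : `|cos r - cos u| <= 1 / L := le_trans (cos_lipschitz r u) rx.
have sin2 t : sin t ^+ 2 = 1 - cos t ^+ 2 :> R.
  by rewrite -(cos2Dsin2 t) addrAC subrr add0r.
have nL : 0 < n%:R * L ^+ 3 by rewrite mulr_gt0 ?ltr0n ?exprn_gt0.
have r0 : 0 < r by exact: lt_le_trans nr.
have tail : `|(n%:R - 1) / r * sin r| <= 1 / L.
  rewrite normrM -[leRHS]mulr1 ler_pM ?normr_sin_le1//.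
  have n1 : 0 <= n%:R - 1 :> R by rewrite subr_ge0 ler1n.
  rewrite normrM normfV !ger0_norm ?(ltW r0)// ler_pdivrMr//.
  apply: (@le_trans _ _ (1 / L * (n%:R * L ^+ 3))); last by rewrite ler_wpM2l// divr_ge0// ltW.
  rewrite (_ : 1 / L * _ = n%:R * L ^+ 2); last by field; rewrite gt_eqF.
  apply: (@le_trans _ _ n%:R); first by rewrite gerBl.
  by rewrite ler_peMr// exprn_ege1.
have c2 : `|cos r ^+ 2 - cos u ^+ 2| <= 2 * (1 / L).
  rewrite subr_sqr normrM mulrC ler_pM//.
  by rewrite (_ : 2 = 1 + 1)// (le_trans (ler_normD _ _))// lerD ?normr_cos_le1.
rewrite !sin2.
rewrite (_ : _ - _ = (cos r - cos u) + (n%:R - 1) / r * sin r + (cos r ^+ 2 - cos u ^+ 2)); last by ring.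
rewrite (_ : 4 / L = 1 / L + 1 / L + 2 * (1 / L)); last by field; rewrite gt_eqF.
by rewrite (le_trans (ler_normD _ _))// lerD// (le_trans (ler_normD _ _))// lerD.
Qed.

End far_cubes.

(** * Both sides of the inequality, tested on the weighted cutoff *)

Section periodic_weight.
Context {R : realType} {N : nat}.
Let n := N.+1.
Implicit Types (x : 'rV[R]_n) (L K m : R) (i : 'I_n).

Let u x := x ord0 ord0.

Let w x := (1 + cos (u x)) ^+ 2.

Let w_ge0 x : 0 <= w x. Proof. exact: sqr_ge0. Qed.

Let normr_1Dcos_le2 x : `|1 + cos (u x)| <= 2.
Proof. by rewrite (_ : 2 = 1 + 1)// (le_trans (ler_normD _ _))// lerD ?normr1 ?normr_cos_le1. Qed.

Let w_le4 x : w x <= 4.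
Proof.
by rewrite -(ger0_norm (w_ge0 x)) normrX (_ : 4 = 2 ^+ 2 :> R) ?ler_pXn2r ?nnegrE//; ring.
Qed.

Let B L : 'rV[R]_n -> R := cutoff (far_center L) L^-1.

Definition test_bump L x : R := w x * (B L x * B L x).

Lemma smooth_test_bump L : smooth (test_bump L).
Proof.
have Cw k : Ck k (fun x : 'rV[R]_n => 1 + cos (u x)).
  by apply: CkD; [exact: Ck_cst|exact: smooth_cos_coord].
move=> k; apply: CkM; first by apply: CkM; exact: Cw.
by apply: CkM; exact: smooth_cutoff.
Qed.

Lemma test_function_cutoff L : 0 < L -> test_function (B L).
Proof.
move=> L0; apply: (@test_function_cube _ _ _ (far_center L) L); first exact: smooth_cutoff.
by move=> x cx; apply: cutoff_eq0; rewrite ?invr_gt0// invrK.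
Qed.

Lemma test_function_test_bump L : 0 < L -> test_function (test_bump L).
Proof.
move=> L0; apply: (@test_function_cube _ _ _ (far_center L) L); first exact: smooth_test_bump.
move=> x cx; rewrite /test_bump (_ : B L x = 0) ?mulr0//.
by apply: cutoff_eq0; rewrite ?invr_gt0// invrK.
Qed.

Lemma test_bump_ge0 L x : 0 <= test_bump L x.
Proof. by rewrite mulr_ge0// mulr_ge0// cutoff_ge0. Qed.

(** The cofactor of [B L] in the gradient of [test_bump L]. It is bounded uniformly in L >= 1 but
    not small: its first summand differentiates the periodic weight, which depends on x_0 alone. *)
Let V L i x := (2 * (1 + cos (u x)) * - sin (u x)) *+ (ord0 == i) * B L x +
               2 * w x * partial i (B L) x.

Lemma partial_test_bump L i x : partial i (test_bump L) x = B L x * V L i x.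
Proof.
apply: derive_val.
have dc := @is_derive_coord R n cos _ ord0 i x (is_derive_cos _).
have d1 := is_deriveD (is_derive_cst (1 : R) x (delta_mx ord0 i)) dc.
have dB := smooth_is_derive i x (@smooth_cutoff R n (far_center L) L^-1).
apply: (is_derive_eq (is_deriveM (is_deriveM d1 d1) (is_deriveM dB dB))).
rewrite /GRing.scale/= -/(B L).
set a := (_ * _ : _ -> R) x; set b := (_ * _ : _ -> R) x; set c := (_ + _ : _ -> R) x.
have -> : a = w x by [].
have -> : b = B L x * B L x by [].
have -> : c = 1 + cos (u x) by [].
by rewrite /V -/(u x); case: (_ == _); rewrite ?mulr1n ?mulr0n; ring.
Qed.

Context (K : R) (K0 : 0 <= K) (HK : forall (c : 'rV[R]_n) s i x, 0 < s ->
  `|partial i (cutoff c s) x| <= (K * s) * \1_(cube c s^-1) x).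

Let normpB L i x : 0 < L ->
  `|partial i (B L) x| <= (K / L) * \1_(cube (far_center L) L) x.
Proof. by move=> L0; have := @HK (far_center L) L^-1 i x; rewrite invrK invr_gt0; apply. Qed.

Let normV L i x : 1 <= L -> `|V L i x| <= 4 + 8 * K.
Proof.
move=> L1; have L0 : 0 < L by exact: lt_le_trans L1.
have b1 : `|B L x| <= 1 by rewrite ger0_norm ?cutoff_ge0 ?cutoff_le1.
have pK : `|partial i (B L) x| <= K.
  apply: le_trans (normpB i x L0) _; rewrite indicE.
  apply: (@le_trans _ _ (K / L)); last by rewrite ler_pdivrMr// ler_peMr.
  by rewrite -[leRHS]mulr1 ler_wpM2l ?divr_ge0 ?(ltW L0)//; case: (_ \in _).
rewrite /V (le_trans (ler_normD _ _))// lerD//.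
  rewrite normrM -[leRHS]mulr1 ler_pM//; case: (_ == _); rewrite ?mulr0n ?normr0// mulr1n.
  rewrite normrM normrN -[leRHS]mulr1 ler_pM ?normr_sin_le1//.
  by rewrite normrM normr_nat (_ : 4 = 2 * 2) ?ler_wpM2l//; ring.
rewrite normrM ler_pM// normrM normr_nat (ger0_norm (w_ge0 x)).
by rewrite (_ : 8 = 2 * 4) ?ler_wpM2l//; ring.
Qed.

(** The derivative along the first axis of [primitive (u x)] times B^2, so its integral is zero:
    with the mean 3/8 subtracted, the weighted potential is a total derivative up to a term with a
    derivative of [B]. *)
Let D L x : R :=
  ((cos (u x) - sin (u x) ^+ 2) * w x - 3 / 8) * (B L x * B L x) +
  primitive (u x) * (2 * B L x * partial ord0 (B L) x).

Let mB L : measurable_fun setT (B L).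
Proof.
by apply: continuous_measurable_rV; apply: smooth_continuous; exact: smooth_cutoff.
Qed.

Let mpB L i : measurable_fun setT (partial i (B L)).
Proof.
apply: continuous_measurable_rV; apply: smooth_partial_continuous.
exact: smooth_cutoff.
Qed.

Let mu_ (g : R -> R) : continuous g -> measurable_fun setT (fun x => g (u x)).
Proof.
move=> cg; apply: measurableT_comp; first exact: continuous_measurable_fun.
exact: measurable_coord.
Qed.

Let continuous_primitive : continuous (@primitive R).
Proof.
move=> t; apply: differentiable_continuous; apply/derivable1_diffP.
by case: (is_derive_primitive t).
Qed.

Let mw : measurable_fun setT w.
Proof.
apply: measurable_funX; apply: measurable_funD => //.
by apply: mu_; exact: continuous_cos.
Qed.

Let mD L : measurable_fun setT (D L).
Proof.
apply: measurable_funD; apply: measurable_funM.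
- apply: measurable_funB => //; apply: measurable_funM => //.
  apply: measurable_funB; first by apply: mu_; exact: continuous_cos.
  by apply: measurable_funX; apply: mu_; exact: continuous_sin.
- exact: measurable_funM.
- by apply: mu_; exact: continuous_primitive.
- by apply: measurable_funM => //; apply: measurable_funM.
Qed.

Let normD L x : 1 <= L -> `|D L x| <= (11 + 8 * K) * \1_(cube (far_center L) L) x.
Proof.
move=> L1; have L0 : 0 < L by exact: lt_le_trans L1.
apply: le_indic_cube x => x cx; last first.
  rewrite /D (_ : B L x = 0) ?mulr0 ?mul0r ?mulr0 ?addr0//.
  by apply: cutoff_eq0; rewrite ?invr_gt0// invrK.
have b1 : `|B L x| <= 1 by rewrite ger0_norm ?cutoff_ge0 ?cutoff_le1.
have pK : `|partial ord0 (B L) x| <= K.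
  apply: le_trans (normpB ord0 x L0) _; rewrite indicE mem_set// mulr1.
  by rewrite ler_pdivrMr// ler_peMr.
rewrite (le_trans (ler_normD _ _))// lerD//.
  rewrite normrM -[leRHS]mulr1 ler_pM//; last by rewrite normrM mulr_ile1.
  rewrite (_ : 11 = 2 * 4 + 3); last by ring.
  rewrite (le_trans (ler_normB _ _))// lerD//; last by rewrite ger0_norm; lra.
  rewrite normrM ler_pM// ?(ger0_norm (w_ge0 x))// (_ : 2 = 1 + 1)//.
  by rewrite (le_trans (ler_normB _ _))// lerD ?normr_cos_le1// normrX exprn_ile1// normr_sin_le1.
rewrite normrM (_ : 8 * K = 4 * (2 * 1 * K)); last by ring.
rewrite ler_pM// ?normr_primitive_le4// normrM ler_pM// normrM normr_nat.
by rewrite ler_wpM2l.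
Qed.

Let integral_D L : 1 <= L -> (\int[lebesgue_rV R n]_x (D L x)%:E = 0)%E.
Proof.
move=> L1; have L0 : 0 < L by exact: lt_le_trans L1.
apply: (integral_partial_eq0 (i := ord0) (G := fun x => primitive (u x) * (B L x * B L x))
    (ltW L0) _ (mD L) (fun x => normD x L1)).
- by rewrite addr_ge0// mulr_ge0.
- move=> x cx; rewrite (_ : B L x = 0) ?mulr0//.
  by apply: cutoff_eq0; rewrite ?invr_gt0// invrK.
- move=> x.
  have dP := @is_derive_coord R n _ _ ord0 ord0 x (is_derive_primitive _).
  have dB := smooth_is_derive ord0 x (@smooth_cutoff R n (far_center L) L^-1).
  apply: (is_derive_eq (is_deriveM dP (is_deriveM dB dB))).
  rewrite eqxx mulr1n /GRing.scale/= -/(B L).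
  set b := (_ * _ : _ -> R) x; have -> : b = B L x * B L x by [].
  by rewrite /D -/(u x) /w; ring.
- move=> x.
  have cu (g : 'rV[R]_n -> R) : continuous g ->
      continuous (fun t : R => g (upd ord0 x t) : R).
    by move=> cg t; apply: continuous_comp; [exact: continuous_upd|exact: cg].
  have cB : continuous (B L) by apply: smooth_continuous; exact: smooth_cutoff.
  have cpB : continuous (partial ord0 (B L)).
    by apply: smooth_partial_continuous; exact: smooth_cutoff.
  have cuu (g : R -> R) : continuous g -> continuous (fun x => g (u x)).
    move=> cg y; apply: (@continuous_comp _ _ _ u g); last exact: cg.
    exact: coord_continuous.
  have cM (f g : 'rV[R]_n -> R) :
      continuous f -> continuous g -> continuous (fun x => f x * g x).
    by move=> cf cg y; exact: cvgM (cf y) (cg y).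
  have cst (k : R) : continuous (fun _ : 'rV[R]_n => k) by exact: cst_continuous.
  have ccos := cuu cos (@continuous_cos R).
  have csin := cuu sin (@continuous_sin R).
  have cw : continuous w.
    have c1 : continuous (fun x => 1 + cos (u x)).
      by move=> y; exact: cvgD (cst 1 y) (ccos y).
    by rewrite /w; under eq_fun do rewrite expr2; exact: cM.
  have c1 : continuous (fun x => (cos (u x) - sin (u x) * sin (u x)) * w x - 3 / 8).
    move=> y; apply: cvgB (cst _ y).
    exact: cvgM (cvgB (ccos y) (cM _ _ csin csin y)) (cw y).
  apply: cu; rewrite /D; under eq_fun do rewrite expr2; move=> y.
  apply: cvgD (cM _ _ (cuu _ continuous_primitive) (cM _ _ (cM _ _ (cst 2) cB) cpB) y).
  exact: (cM _ _ c1 (cM _ _ cB cB) y).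
Qed.

Let m : R := (expR (- 2) * expR (- 2)) ^+ n.

Let m_ge0 : 0 <= m.
Proof. by rewrite exprn_ge0// mulr_ge0// expR_ge0. Qed.

(** With cos - sin^2 in place of sigma, the product with the bump is exactly 3/8 B^2 + D - primitive
    2 B d_0 B. The replacement costs (4 / L) 4 = 16 / L, the last term at most 4 (2 K / L), and B^2
    >= m^2 on the half-size cube. *)
Let lower_bound L x : 1 <= L ->
  3 / 8 * m ^+ 2 * \1_(cube (far_center L) (L / 2)) x + D L x <=
  sigma_potential x * test_bump L x +
  (16 + 8 * K) / L * \1_(cube (far_center L) L) x.
Proof.
move=> L1; have L0 : 0 < L by exact: lt_le_trans L1.
have [cx|cx] := pselect (cube (far_center L) L x); last first.
  have B0 : B L x = 0 by apply: cutoff_eq0; rewrite ?invr_gt0// invrK.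
  have ncx : ~ cube (far_center L) (L / 2) x.
    move=> H; apply: cx => i; apply: le_trans (H i) _.
    by rewrite ler_pdivrMr// ler_peMr ?(ltW L0)// ler1n.
  by rewrite !indicE !memNset// /test_bump /D B0 !(mulr0, mul0r, addr0).
have b1 : `|B L x| <= 1 by rewrite ger0_norm ?cutoff_ge0 ?cutoff_le1.
have half : m ^+ 2 * \1_(cube (far_center L) (L / 2)) x <= B L x * B L x.
  rewrite indicE; have [hx|hx] := pselect (cube (far_center L) (L / 2) x); last first.
    by rewrite memNset// mulr0 mulr_ge0// cutoff_ge0.
  rewrite mem_set// mulr1 -expr2 ler_pXn2r ?nnegrE ?cutoff_ge0//.
  by apply: cutoff_lower; rewrite ?invr_gt0// invrK.
have pK : `|partial ord0 (B L) x| <= K / L.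
  by apply: le_trans (normpB ord0 x L0) _; rewrite indicE mem_set// mulr1.
have far := sigma_potential_far_cube L1 cx.
have err1 : `|(sigma_potential x - (cos (u x) - sin (u x) ^+ 2)) * test_bump L x| <= 16 / L.
  rewrite normrM (_ : 16 / L = 4 / L * (4 * (1 * 1))); last by field; rewrite gt_eqF.
  by rewrite ler_pM// normrM ler_pM ?(ger0_norm (w_ge0 x))// normrM ler_pM.
have err2 : `|primitive (u x) * (2 * B L x * partial ord0 (B L) x)| <= 8 * K / L.
  rewrite normrM (_ : 8 * K / L = 4 * (2 * 1 * (K / L))); last by field; rewrite gt_eqF.
  rewrite ler_pM ?normr_primitive_le4// normrM ler_pM// normrM normr_nat.
  by rewrite ler_wpM2l.
rewrite [\1_(cube _ L) x]indicE mem_set// mulr1 (mulrDl 16).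
move: err1 err2; rewrite !ler_norml => /andP[err1 _] /andP[_ err2].
rewrite /D; move: err1; rewrite mulrBl.
have -> : ((cos (u x) - sin (u x) ^+ 2) * w x - 3 / 8) * (B L x * B L x) =
  (cos (u x) - sin (u x) ^+ 2) * test_bump L x - 3 / 8 * (B L x * B L x).
  by rewrite /test_bump; ring.
move: half err2; rewrite -(mulrA (3 / 8) (m ^+ 2)).
set a := m ^+ 2 * _; set b := B L x * B L x; set c := primitive _ * _.
set d := _ * test_bump L x; set e := _ * test_bump L x.
set p := 16 / L; set q := 8 * K / L.
by lra.
Qed.

Lemma distr_sigma_potential_test_bump L : 1 <= L ->
  ((3 / 8 * m ^+ 2 * L ^+ n - (16 + 8 * K) / L * (2 * L) ^+ n)%:E <=
   distr_of_fun sigma_potential (test_bump L))%E.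
Proof.
move=> L1; have L0 : 0 < L by exact: lt_le_trans L1.
have L20 : 0 <= L / 2 by rewrite divr_ge0// ltW.
have c1 : 0 <= 3 / 8 * m ^+ 2 by rewrite mulr_ge0// ?sqr_ge0//; lra.
have c2 : 0 <= (16 + 8 * K) / L by rewrite divr_ge0 ?(ltW L0)// addr_ge0// mulr_ge0.
have i1 : (lebesgue_rV R n).-integrable setT
    (EFin \o (fun x => 3 / 8 * m ^+ 2 * \1_(cube (far_center L) (L / 2)) x)).
  apply: (integrable_cube L20 c1 (measurable_indic_cube _ _ _)) => x.
  by rewrite ger0_norm// mulr_ge0.
have i2 : (lebesgue_rV R n).-integrable setT
    (EFin \o (fun x => (16 + 8 * K) / L * \1_(cube (far_center L) L) x)).
  apply: (integrable_cube (ltW L0) c2 (measurable_indic_cube _ _ _)) => x.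
  by rewrite ger0_norm// mulr_ge0.
have c3 : 0 <= 11 + 8 * K by rewrite addr_ge0// mulr_ge0.
have iD := integrable_cube (ltW L0) c3 (mD L) (fun x => normD x L1).
have isigma : (lebesgue_rV R n).-integrable setT
    (EFin \o (fun x => sigma_potential x * test_bump L x)).
  apply: (@integrable_cube _ _ _ (far_center L) L ((n%:R + 3) * (4 * (1 * 1)))).
  - exact: ltW.
  - by rewrite !mulr_ge0// addr_ge0.
  - apply: measurable_funM; first exact: measurable_sigma_potential.
    by apply: measurable_funM => //; exact: measurable_funM.
  apply: le_indic_cube => x cx; last first.
    rewrite /test_bump (_ : B L x = 0) ?mulr0//.
    by apply: cutoff_eq0; rewrite ?invr_gt0// invrK.
  have b1 : `|B L x| <= 1 by rewrite ger0_norm ?cutoff_ge0 ?cutoff_le1.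
  rewrite normrM ler_pM ?normr_sigma_potential_le//.
  by rewrite normrM ler_pM ?(ger0_norm (w_ge0 x))// normrM ler_pM.
have : (\int[lebesgue_rV R n]_x
    ((3 / 8 * m ^+ 2 * \1_(cube (far_center L) (L / 2)) x)%:E + (D L x)%:E) <=
  \int[lebesgue_rV R n]_x ((sigma_potential x * test_bump L x)%:E +
    ((16 + 8 * K) / L * \1_(cube (far_center L) L) x)%:E))%E.
  apply: le_integral => //; [exact: integrableD|exact: integrableD|].
  by move=> x _ /=; rewrite -!EFinD lee_fin; exact: lower_bound.
rewrite integralD// integralD// integral_D// adde0 !integral_cube ?(ltW L0)//.
rewrite EFinB leeBlDr// mulrACA -mulrA.
by rewrite (_ : 2 * (L / 2) = L)//; field.
Qed.

Context (Phi : 'rV[R]_n -> 'rV[R]_n) (C : R) (mPhi : measurable_fun setT Phi).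
Context (C0 : 0 < C) (Phi_form : forall h : 'rV[R]_n -> R, test_function h ->
  (\int[lebesgue_rV R n]_x (`|h x| ^+ 2 * sqnorm_rV (Phi x))%:E <=
    C%:E * dirichlet h)%E).

Let dirichlet_cutoff L : 0 < L ->
  (dirichlet (B L) <= (n%:R * (K / L) ^+ 2 * (2 * L) ^+ n)%:E)%E.
Proof.
move=> L0; have KL : 0 <= K / L by rewrite divr_ge0// ltW.
have c0 : 0 <= n%:R * (K / L) ^+ 2 by rewrite mulr_ge0// sqr_ge0.
rewrite -(integral_cube (far_center L) (ltW L0) c0).
apply: ge0_le_integral => //.
- by move=> x _; rewrite lee_fin sqnorm_rV_ge0.
- apply/measurable_EFinP; apply: measurable_sqnorm; apply/measurable_fun_rVP => i.
  rewrite (_ : _ \o _ = partial i (B L)); first exact: mpB.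
  by apply/funext => x; rewrite /coord_rV /= mxE.
- by apply/measurable_EFinP; exact: measurable_indic_cube.
move=> x _; rewrite lee_fin /sqnorm_rV mulr_natl mulrnAl -[in leRHS](card_ord n) -sumr_const.
apply: ler_sum => i _; rewrite mxE -real_normK ?num_real//.
rewrite (_ : \1_ _ x = \1_(cube (far_center L) L) x ^+ 2).
  rewrite -exprMn ler_pXn2r ?nnegrE ?mulr_ge0 ?invr_ge0 ?(ltW L0)//; exact: normpB.
by rewrite indicE; case: (_ \in _); rewrite ?expr1n ?expr0n.
Qed.

(** In each coordinate, |B Phi_i| |V_i| <= L/2 (B Phi_i)^2 + V_i^2 / (2 L), and the uniform bound on
    V_i then applies. *)
Let dot_bound L x : 1 <= L ->
  `|dot_rV (Phi x) (gradient (test_bump L) x)| <=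
  L / 2 * (`|B L x| ^+ 2 * sqnorm_rV (Phi x)) +
  n%:R * ((4 + 8 * K) ^+ 2 / (2 * L)) * \1_(cube (far_center L) L) x.
Proof.
move=> L1; have L0 : 0 < L by exact: lt_le_trans L1.
rewrite /dot_rV (le_trans (ler_norm_sum _ _ _))//.
rewrite real_normK ?num_real// /sqnorm_rV mulr_sumr mulr_sumr mulr_natl mulrnAl.
rewrite -[X in _ + _ *+ X](card_ord n) -sumr_const -big_split/=.
apply: ler_sum => i _; rewrite mxE partial_test_bump.
have [cx|cx] := pselect (cube (far_center L) L x); last first.
  have -> : B L x = 0 by apply: cutoff_eq0; rewrite ?invr_gt0// invrK.
  by rewrite indicE memNset// !(mul0r, mulr0, normr0, expr0n, addr0).
rewrite indicE mem_set// mulr1 mulrA normrM.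
have vK : `|V L i x| ^+ 2 <= (4 + 8 * K) ^+ 2.
  by rewrite ler_pXn2r ?nnegrE ?addr_ge0 ?mulr_ge0//; exact: normV.
apply: (@le_trans _ _ (L / 2 * (B L x ^+ 2 * Phi x ord0 i ^+ 2) + `|V L i x| ^+ 2 / (2 * L))).
  have -> : B L x ^+ 2 * Phi x ord0 i ^+ 2 = `|Phi x ord0 i * B L x| ^+ 2.
    by rewrite real_normK ?num_real// exprMn mulrC.
  set a := `|_ * _|; set b := `|V L i x|.
  rewrite -subr_ge0 (_ : _ - _ = (L * a - b) ^+ 2 / (2 * L)); last by field; rewrite gt_eqF.
  by rewrite divr_ge0 ?sqr_ge0// mulr_ge0// ltW.
by rewrite lerD2l ler_wpM2r// invr_ge0 mulr_ge0// ltW.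
Qed.

Lemma distr_div_test_bump L : 1 <= L ->
  (distr_div Phi (test_bump L) <=
   ((2 * L) ^+ n / L * (n%:R * C * K ^+ 2 / 2 + n%:R * (4 + 8 * K) ^+ 2 / 2))%:E)%E.
Proof.
move=> L1; have L0 : 0 < L by exact: lt_le_trans L1.
have mi i : measurable_fun setT (fun x => Phi x ord0 i).
  by move/measurable_fun_rVP: mPhi => /(_ i).
have mg : measurable_fun setT (fun x => dot_rV (Phi x) (gradient (test_bump L) x)).
  apply: measurable_sum => i; apply: measurable_funM => //.
  rewrite (_ : (fun x => _) = partial i (test_bump L)).
    apply: continuous_measurable_rV; apply: smooth_partial_continuous.
    exact: smooth_test_bump.
  by apply/funext => x; rewrite mxE.
have mBP : measurable_fun setT (fun x => `|B L x| ^+ 2 * sqnorm_rV (Phi x)).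
  apply: measurable_funM; last exact: measurable_sqnorm.
  by apply: measurable_funX; apply: measurableT_comp (mB L); exact: normr_measurable.
have c0 : 0 <= n%:R * ((4 + 8 * K) ^+ 2 / (2 * L)).
  by rewrite mulr_ge0// divr_ge0 ?sqr_ge0// mulr_ge0// ltW.
have L2 : 0 <= L / 2 by rewrite divr_ge0// ltW.
(* After passing to absolute values all integrands are nonnegative, so the integrals can be compared
   and split by measurability alone. *)
rewrite /distr_div (le_trans (lee_abs _))// abseN.
apply: le_trans (le_abse_integral _ measurableT _) _; first exact/measurable_EFinP.
apply: (@le_trans _ _ (\int[lebesgue_rV R n]_x
  ((L / 2)%:E * (`|B L x| ^+ 2 * sqnorm_rV (Phi x))%:E +
   (n%:R * ((4 + 8 * K) ^+ 2 / (2 * L)) * \1_(cube (far_center L) L) x)%:E))%E).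
  apply: ge0_le_integral => //.
  - by apply: measurableT_comp => //; exact/measurable_EFinP.
  - apply: emeasurable_funD; last by apply/measurable_EFinP; exact: measurable_indic_cube.
    by apply: measurable_funeM; exact/measurable_EFinP.
  - by move=> x _; rewrite -EFinM -EFinD lee_fin; exact: dot_bound.
have BP0 x : (0 <= (`|B L x| ^+ 2 * sqnorm_rV (Phi x))%:E)%E.
  by rewrite lee_fin mulr_ge0 ?sqr_ge0 ?sqnorm_rV_ge0.
rewrite ge0_integralD//; last 4 first.
- by move=> x _; rewrite mule_ge0.
- by apply: measurable_funeM; exact/measurable_EFinP.
- by move=> x _; rewrite lee_fin mulr_ge0.
- by apply/measurable_EFinP; exact: measurable_indic_cube.
rewrite ge0_integralZl//; last exact/measurable_EFinP.
rewrite integral_cube ?(ltW L0)//.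
apply: (@le_trans _ _ ((L / 2)%:E * (C%:E * (n%:R * (K / L) ^+ 2 * (2 * L) ^+ n)%:E) +
   (n%:R * ((4 + 8 * K) ^+ 2 / (2 * L)) * (2 * L) ^+ n)%:E)%E).
  rewrite leeD2r// lee_wpmul2l//.
  apply: le_trans (Phi_form (test_function_cutoff L0)) _.
  by rewrite lee_wpmul2l ?lee_fin ?(ltW C0)//; exact: dirichlet_cutoff.
rewrite -!EFinM -EFinD lee_fin le_eqVlt; apply/orP; left; apply/eqP.
set A := (2 * L) ^+ n; by field; rewrite gt_eqF.
Qed.

End periodic_weight.

Theorem proposition1p4 (R : realType) (n : nat) (n_ge1 : (1 <= n)%N) :
  (forall h : 'rV[R]_n -> R, test_function h ->
     (distr_of_fun sigma_potential (fun x => (h x ^+ 2)%R) <= dirichlet h)%E) /\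
  ~ (exists (Phi : 'rV[R]_n -> 'rV[R]_n) (C : R),
       [/\ L2loc Phi,
           0 < C,
           distr_le (distr_of_fun sigma_potential) (distr_div Phi) &
           forall h : 'rV[R]_n -> R, test_function h ->
             (\int[lebesgue_rV R n]_x (`|h x| ^+ 2 * sqnorm_rV (Phi x))%:E
                <= C%:E * dirichlet h)%E]).
Proof.
split; first by move=> h; exact: sigma_potential_form_le.
case: n n_ge1 => [//|N _] [Phi [C [[mPhi _] C0 sigma_le form]]].
have [K K0 HK] := @normr_partial_cutoff R N.+1.
pose m : R := (expR (- 2) * expR (- 2)) ^+ N.+1.
have m0 : 0 < 3 / 8 * m ^+ 2.
  by rewrite mulr_gt0 ?exprn_gt0 ?mulr_gt0 ?expR_gt0//; lra.
(* [Q] gathers the errors of both sides, all multiples of (2 L)^n / L. *)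
pose Q : R := 16 + 8 * K + (N.+1%:R * C * K ^+ 2 / 2 + N.+1%:R * (4 + 8 * K) ^+ 2 / 2).
have Q0 : 0 <= Q.
  rewrite addr_ge0//; first by rewrite addr_ge0// mulr_ge0.
  rewrite addr_ge0// divr_ge0// mulr_ge0 ?sqr_ge0//.
  by rewrite mulr_ge0// ltW.
(* Chosen so that 3/8 m^2 L exceeds 2^n Q by exactly 3/8 m^2. *)
pose L : R := 1 + 2 ^+ N.+1 * Q / (3 / 8 * m ^+ 2).
have L1 : 1 <= L by rewrite lerDl divr_ge0 ?(ltW m0)// mulr_ge0// exprn_ge0.
have L0 : 0 < L by exact: lt_le_trans L1.
have := le_trans (distr_sigma_potential_test_bump K0 HK L1)
  (le_trans (sigma_le _ (test_function_test_bump L0) (test_bump_ge0 L))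
            (distr_div_test_bump K0 HK mPhi C0 form L1)).
rewrite lee_fin lerBlDr -/m => main.
have : 3 / 8 * m ^+ 2 * L <= 2 ^+ N.+1 * Q.
  (* Both sides are multiplied by L^(n-1), as L^n followed by L^-1, to meet the form of [main]. *)
  rewrite -(ler_pM2r (exprn_gt0 N.+1 L0)) -(ler_pM2r (_ : 0 < L^-1)) ?invr_gt0//.
  rewrite (_ : 3 / 8 * m ^+ 2 * L * L ^+ N.+1 / L = 3 / 8 * m ^+ 2 * L ^+ N.+1).
    apply: le_trans main _; rewrite exprMn le_eqVlt; apply/orP; left; apply/eqP.
    by rewrite /Q; set A := 2 ^+ N.+1; set B := L ^+ N.+1; field; rewrite gt_eqF.
  by set B := L ^+ N.+1; field; rewrite gt_eqF.
apply/negP; rewrite -ltNge (_ : _ * L = 3 / 8 * m ^+ 2 + 2 ^+ N.+1 * Q) ?ltrDr//.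
by rewrite /L [LHS](mulrDr (3 / 8 * m ^+ 2)) mulr1 [X in _ + X]mulrC divfK// gt_eqF.
Qed.
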